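(* Suppose that the following three hypotheses hold. System: (a) $f(\mathbf 0_n,\mathbf 0_m)=\mathbf 0_n$ and $\Delta f_t(\mathbf 0_n,\mathbf 0_m)=\mathbf 0_n$ for all $t\in\mathbb N$; (b) $\mathbf 0_m$ lies in the interior of $\mathcal U$; (c) there is $L_f\in(0,\infty)$ with $\|f(x',u)-f(x'',u)\|\le L_f\|x'-x''\|$ for all $x',x''\in\mathcal X$, $u\in\mathcal U$; (d) for all $t\in\mathbb N$, $\|\Delta f_t(x',u')-\Delta f_t(x'',u'')\|\le L_{\Delta f}(\varepsilon_f)(\|x'-x''\|+\|u'-u''\|)$ for all $x',x''\in\mathcal X$, $u',u''\in\mathcal U$, where $\varepsilon_f\in[0,\bar\varepsilon_f]$ is the mismatch level, $L_{\Delta f}:\mathbb R_+\to\mathbb R_+$ is increasing and continuous with $\lim_{\varepsilon\searrow0}L_{\Delta f}(\varepsilon)=0$, and $\bar L_{\Delta f}:=L_{\Delta f}(\bar\varepsilon_f)$. Cost controllability: there is a constant $\overline\gamma$ such that for every horizon $i\in\mathbb I_{1:\infty}$ there is $\gamma_i\in(0,\overline\gamma]$ with $V_i(x;f)\le(1+\gamma_i)\ell^\star(x)$ for all $x\in\mathcal X_{\mathrm{ROA}}(\ell)$. Terminal cost (relaxed control Lyapunov function): there is $\kappa_{\mathrm T}\in\mathbb R_+$ such that $\min_{u\in\mathcal U}\{\ell_{\mathrm T}(f(x,u))+\ell(x,u)\}\le(1+\kappa_{\mathrm T})\ell^\star(x)$ for all $x\in\mathcal X_{\mathrm{ROA}}(\ell)$.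 Let $M,N\in\mathbb N$ with $1\le M\le N-1$, and define $$\rho_{N,M}(\varepsilon_f):=\delta_{N,M}+\alpha_{N,M}(\varepsilon_f),$$ with $\delta_{N,M}$, $\alpha_{N,M}$ (and $\beta_N$, $\beta_\infty$, $\theta_M$ below) as defined in the context. If $\rho_{N,M}(\varepsilon_f)<1$, then: (i) The asynchronous closed-loop true system $$x_{j,k+1}=f^\ast_{t_j+k}(x_{j,k},\nu^\star_{j,k}(f)),\qquad j\in\mathbb I_{1:\infty},\ k\in\mathbb I_{0:m_j-1},$$ with $x_{j+1,0}=x_{j,m_j}$, is asymptotically stable at the origin under the asynchronous certainty-equivalence MPC controller specified by $\mathrm P_{\mathrm{MPC}}(x_t;f)$ and the feedback time sequence $\mathcal T_M$. (ii) With initial state $x_0=x_{1,0}=x\in\mathcal X_{\mathrm{ROA}}(\ell)$, the infinite-horizon performance satisfies $$\mathcal J^{[N,M]}_\infty(x;f)\le R^\ast_{N,M}(\varepsilon_f)\,V_\infty(x;F^\ast_{0,\infty}),$$ where $$R^\ast_{N,M}(\varepsilon_f)=\frac{\big[1+\min\{\overline\gamma,\beta_N(\varepsilon_f)\}\big]\big[1+\theta_M(\varepsilon_f)\big]}{1-\rho_{N,M}(\varepsilon_f)}\left[1+\frac{\overline\lambda_P}{\underline\lambda_Q}\left(\frac{\bar\gamma^\ast(\varepsilon_f)}{1+\bar\gamma^\ast(\varepsilon_f)}\right)^N\right],$$ with $\bar\gamma^\ast(\varepsilon_f):=\overline\gamma+\beta_\infty(\varepsilon_f)+\overline\gamma\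,\beta_\infty(\varepsilon_f)$.
   Context: Notation. $\mathbb N$ contains $0$; $\mathbb I_{a:b}=\mathbb N\cap[a,b]$ and $\mathbb I_{1:\infty}=\{1,2,\dots\}$; $\mathbb R_+=[0,\infty)$; $\|\cdot\|$ is the 2-norm; $\|x\|_Q^2=x^\top Qx$; $\overline\lambda_S,\underline\lambda_S$ are the largest and smallest eigenvalues of a symmetric positive definite matrix $S$. Empty sums are $0$. System. $\mathcal X=\mathbb R^n$, $\mathcal U\subseteq\mathbb R^m$ is closed. The true system is $x_{t+1}=f^\ast_t(x_t,u_t)=f(x_t,u_t)+\Delta f_t(x_t,u_t)$, $t\in\mathbb N$, with nominal model $f:\mathcal X\times\mathcal U\to\mathcal X$ and unknown mismatch $\Delta f_t:\mathcal X\times\mathcal U\to\mathcal X$. Write $F^\ast_{t,N}=\{f^\ast_\tau\}_{\tau=t}^{t+N-1}$, $F^\ast_{0,\infty}=\{f^\ast_t\}_{t=0}^\infty$. Costs. $\ell(x,u)=\|x\|_Q^2+\|u\|_R^2$ with $Q,R\succ0$; $\ell^\star(x)=\min_{u\in\mathcal U}\ell(x,u)=\|x\|_Q^2$; terminal cost $\ell_{\mathrm T}(x)=\|x\|_P^2$ with $P\succeq Q$. Infinite-horizon optimal control. $V_\infty(x;F^\ast_{0,\infty})$ is the optimal value of minimizing $\sum_{k=0}^\infty\ell(\xi_k,\nu_k)$ subject to $\xi_0=x$, $\xi_{k+1}=f^\ast_k(\xi_k,\nu_k)$, $\nu_k\in\mathcal U$ for all $k\in\mathbb N$. The region of attraction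 $\mathcal X_{\mathrm{ROA}}(\ell)$ is the set of $x\in\mathcal X$ with $V_\infty(x;F^\ast_{0,\infty})<\infty$. It is a standing assumption that the initial state $x_0$ lies in $\mathcal X_{\mathrm{ROA}}(\ell)$ and that this problem is well-posed (it has a global minimizer with finite value). MPC. For prediction horizon $N$, $\mathrm P_{\mathrm{MPC}}(x_t;f)$ is the problem of minimizing $\sum_{k=0}^{N-1}\ell(\xi_{k|t},\nu_{k|t})+\ell_{\mathrm T}(\xi_{N|t})$ subject to $\xi_{0|t}=x_t$, $\xi_{k+1|t}=f(\xi_{k|t},\nu_{k|t})$, $\nu_{k|t}\in\mathcal U$ for $k\in\mathbb I_{0:N-1}$. Its optimal value as a function of the initial state is $V_N(\cdot;f)$; optimal solutions (here and for the analogous problem with the true dynamics $F^\ast_{t,N}$) are taken to exist, and a fixed optimal solution is denoted $\{\nu^\star_{k|t}(f)\}_{k=0}^{N-1}$, $\{\xi^\star_{k|t}(f)\}_{k=0}^{N}$. Asynchronous feedback. $\mathcal T_M=\{t_1,t_2,\dots\}\subset\mathbb N$ is any sequence with $t_1=0$ and $t_j+1\le t_{j+1}\le t_j+M$; $m_j=t_{j+1}-t_j\le M$. The MPC problem (with the nominal model) is solved only at the times $t_j$ from the measured true state $x_{t_j}$, and the inputs $\nu^\star_{j,k}(f):=\nu^\star_{k|t_j}(f)$, $k\in\mathbb I_{0:m_j-1}$, are applied to the true system at times $t_j+k$. Write $x_{j,k}:=x_{t_j+k}$ for the true closed-loop state. The infinite-horizon performance is $\mathcal J^{[N,M]}_\infty(x;f)=\sum_{j=1}^\infty\sum_{k=0}^{m_j-1}\ell(x_{j,k},\nu^\star_{j,k}(f))$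 with $x_{1,0}=x$. Constants (with $L_f$, $L_{\Delta f}$, $\bar L_{\Delta f}$, $\overline\gamma$, $\gamma_N$, $\kappa_{\mathrm T}$ the quantities appearing in the hypotheses of the claim). $\mu_{\mathrm{ce}}=2(\underline\lambda_Q^{-1}+\underline\lambda_R^{-1})$; $\bar\zeta_k=\mu_{\mathrm{ce}}\sum_{i=0}^{k-1}(L_f+\bar L_{\Delta f})^{2i}$; $\zeta_k=\mu_{\mathrm{ce}}\sum_{i=0}^{k-1}L_f^{2i}$; $$\delta_{N,k}=\frac{(1+\overline\gamma)\gamma_N[(1+\kappa_{\mathrm T})^k-1]}{1+\overline\gamma+(N-k)(1+\kappa_{\mathrm T})^k};$$ $\sigma_{N,1}=\frac{\overline\lambda_Q^2}{\underline\lambda_Q}\sum_{k=0}^{N-1}L_f^{2k}+\frac{\overline\lambda_P^2}{\underline\lambda_P}L_f^{2N}$; $\sigma_{N,2}=\overline\lambda_Q\sum_{k=0}^{N-1}L_f^{2k}+\overline\lambda_PL_f^{2N}$. $\alpha_{N,k}(\varepsilon)=\alpha^{(1)}_{N,k}L_{\Delta f}(\varepsilon)+\alpha^{(2)}_{N,k}[L_{\Delta f}(\varepsilon)]^2$ with $\alpha^{(1)}_{N,k}=2\{\sigma_{N,1}(\gamma_N+\delta_{N,k})\bar\zeta_k\}^{1/2}$, $\alpha^{(2)}_{N,k}=\sigma_{N,2}\bar\zeta_k$. $\beta_N(\varepsilon)=\beta^{(1)}_NL_{\Delta f}(\varepsilon)+\beta^{(2)}_N[L_{\Delta f}(\varepsilon)]^2$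 with $\beta^{(1)}_N=2\big(\frac{\overline\lambda_Q^2}{\underline\lambda_Q}\sum_{k=1}^{N-1}\zeta_k+\frac{\overline\lambda_P^2}{\underline\lambda_P}\zeta_N\big)^{1/2}$, $\beta^{(2)}_N=\overline\lambda_Q\sum_{k=1}^{N-1}\zeta_k+\overline\lambda_P\zeta_N$. $\beta_\infty(\varepsilon)=\lim_{N\to\infty}\beta_N(\varepsilon)\in[0,\infty]$; if this is $+\infty$, the ratio $\bar\gamma^\ast/(1+\bar\gamma^\ast)$ is read as its limit $1$. $\theta_k(\varepsilon)=\theta^{(1)}_kL_{\Delta f}(\varepsilon)+\theta^{(2)}_k[L_{\Delta f}(\varepsilon)]^2$ with $\theta^{(1)}_k=\frac{2\overline\lambda_Q}{\underline\lambda_Q^{1/2}}\big(\sum_{i=1}^{k-1}\bar\zeta_i\big)^{1/2}$, $\theta^{(2)}_k=\overline\lambda_Q\sum_{i=1}^{k-1}\bar\zeta_i$.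
   Formalization: The formal theorem adds two assumptions, without which the claim is false: nominal optimal predictions of every horizon started in the region of attraction stay in it, and the measured states at the update times of the closed loop started in it remain in it. *)

(* Defs.v *)
From HB Require Import structures.
From mathcomp Require Import all_boot all_order all_algebra.
From mathcomp Require Import all_classical all_reals all_analysis.

Set Implicit Arguments.
Unset Strict Implicit.
Unset Printing Implicit Defensive.

Import Order.TTheory GRing.Theory Num.Theory.
Import numFieldNormedType.Exports.

Local Open Scope classical_set_scope.
Local Open Scope ring_scope.

(* Quadratic forms. The library norm on matrices is the max norm, hence the
   explicit Euclidean norm; the two induce the same topology. *)

Definition qform (R : realType) n (S : 'M[R]_n) (x : 'cV[R]_n) : R :=
  (x^T *m S *m x) 0 0.

Definition norm2 (R : realType) n (x : 'cV[R]_n) : R :=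
  Num.sqrt ((x^T *m x) 0 0).

Definition posdef (R : realType) n (S : 'M[R]_n) : Prop :=
  S^T = S /\ forall x : 'cV[R]_n, x != 0 -> 0 < qform S x.

(* The Loewner order on symmetric matrices: S1 >= S2. *)
Definition loewner_ge (R : realType) n (S1 S2 : 'M[R]_n) : Prop :=
  [/\ S1^T = S1, S2^T = S2 & forall x : 'cV[R]_n, 0 <= qform (S1 - S2) x].

(* [sup] and [inf] over a finite set, nonempty for symmetric S and n > 0. *)
Definition eig_max (R : realType) n (S : 'M[R]_n) : R :=
  sup [set a : R | eigenvalue S a].

Definition eig_min (R : realType) n (S : 'M[R]_n) : R :=
  inf [set a : R | eigenvalue S a].

(* Maps on X * U are total functions here; their values are only ever
   constrained and used at inputs in U. *)
Record plant (R : realType) (n m : nat) := Plant {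
  inputs : set 'cV[R]_m;
  nominal : 'cV[R]_n -> 'cV[R]_m -> 'cV[R]_n;
  mismatch : nat -> 'cV[R]_n -> 'cV[R]_m -> 'cV[R]_n;
  Qw : 'M[R]_n;
  Rw : 'M[R]_m;
  Pw : 'M[R]_n
}.

Section Plant.
Context (R : realType) (n m : nat) (p : plant R n m).

Local Notation state := 'cV[R]_n.
Local Notation input := 'cV[R]_m.
Local Notation dynamics := (nat -> state -> input -> state).

Definition fnom : dynamics := fun _ => nominal p.

Definition fstar : dynamics := fun t x u => nominal p x u + mismatch p t x u.

Definition shift (t : nat) (F : dynamics) : dynamics := fun k => F (t + k)%N.

Definition ell (x : state) (u : input) : R := qform (Qw p) x + qform (Rw p) u.

Definition ell_star (x : state) : R := inf [set ell x u | u in inputs p].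

Definition ellT (x : state) : R := qform (Pw p) x.

Fixpoint traj (F : dynamics) (x : state) (nu : nat -> input) (k : nat) : state :=
  if k is k'.+1 then F k' (traj F x nu k') (nu k') else x.

(* Only nu 0, ..., nu (N - 1) matter at horizon N. *)
Definition admissible (N : nat) (nu : nat -> input) : Prop :=
  forall k, (k < N)%N -> inputs p (nu k).

Definition cost (N : nat) (F : dynamics) (x : state) (nu : nat -> input) : R :=
  \sum_(0 <= k < N) ell (traj F x nu k) (nu k) + ellT (traj F x nu N).

Definition VN (N : nat) (F : dynamics) (x : state) : R :=
  inf [set cost N F x nu | nu in admissible N].

Definition optimal (N : nat) (F : dynamics) (x : state) (nu : nat -> input) :=
  admissible N nu /\
  forall nu', admissible N nu' -> cost N F x nu <= cost N F x nu'.

Definition admissible_oo (nu : nat -> input) : Prop :=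
  forall k, inputs p (nu k).

Definition cost_oo (F : dynamics) (x : state) (nu : nat -> input) : \bar R :=
  (\sum_(0 <= k <oo) (ell (traj F x nu k) (nu k))%:E)%E.

Definition Voo (F : dynamics) (x : state) : \bar R :=
  ereal_inf [set cost_oo F x nu | nu in admissible_oo].

Definition optimal_oo (F : dynamics) (x : state) (nu : nat -> input) : Prop :=
  admissible_oo nu /\
  forall nu', admissible_oo nu' -> (cost_oo F x nu <= cost_oo F x nu')%E.

Definition roa : set state := [set x | (Voo fstar x < +oo)%E].

Definition standing : Prop :=
  [/\ closed (inputs p), posdef (Qw p), posdef (Rw p) &
      loewner_ge (Pw p) (Qw p)].

Definition optimizers_exist : Prop :=
  [/\ forall x, roa x -> exists nu, optimal_oo fstar x nu,
      forall N x, (1 <= N)%N -> exists nu, optimal N fnom x nu &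
      forall t N x, (1 <= N)%N -> exists nu, optimal N (shift t fstar) x nu].

Definition system_hyp (Lf : R) (LD : R -> R) (eps epsbar : R) : Prop :=
  [/\ nominal p 0 0 = 0 /\ (forall t, mismatch p t 0 0 = 0),
      interior (inputs p) 0,
      0 < Lf /\
        (forall x' x'' u, inputs p u ->
          norm2 (nominal p x' u - nominal p x'' u) <= Lf * norm2 (x' - x'')),
      [/\ 0 <= eps <= epsbar,
          forall e : R, 0 <= e -> 0 <= LD e,
          forall e1 e2 : R, 0 <= e1 -> e1 <= e2 -> LD e1 <= LD e2,
          {within `[0, +oo[, continuous LD} &
          LD e @[e --> 0^'+] --> (0 : R)] &
      forall t x' x'' u' u'', inputs p u' -> inputs p u'' ->
        norm2 (mismatch p t x' u' - mismatch p t x'' u'')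
          <= LD eps * (norm2 (x' - x'') + norm2 (u' - u''))].

Definition cost_controllable (gbar : R) (gam : nat -> R) : Prop :=
  forall i, (1 <= i)%N ->
    0 < gam i <= gbar /\
    forall x, roa x -> VN i fnom x <= (1 + gam i) * ell_star x.

Definition relaxed_clf (kT : R) : Prop :=
  0 <= kT /\
  forall x, roa x ->
    inf [set ellT (nominal p x u) + ell x u | u in inputs p]
      <= (1 + kT) * ell_star x.

(* Update times are indexed from 0: [tau j] is the
   (j+1)-st one, so [tau 0] = 0. *)

Definition feedback_times (M : nat) (tau : nat -> nat) : Prop :=
  tau 0%N = 0%N /\
  forall j, ((tau j).+1 <= tau j.+1)%N && (tau j.+1 <= tau j + M)%N.

(* [nus j y] is the input sequence selected at the j-th update when the measured
   state is y. *)
Definition mpc_controller (N : nat) (nus : nat -> state -> nat -> input) : Prop :=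
  forall j y, optimal N fnom y (nus j y).

Definition closed_loop (tau : nat -> nat) (nus : nat -> state -> nat -> input)
    (x : nat -> state) : Prop :=
  forall j k, (k < tau j.+1 - tau j)%N ->
    x (tau j + k).+1 = fstar (tau j + k) (x (tau j + k)%N) (nus j (x (tau j)) k).

Definition performance (tau : nat -> nat) (nus : nat -> state -> nat -> input)
    (x : nat -> state) : \bar R :=
  (\sum_(0 <= j <oo)
     (\sum_(0 <= k < tau j.+1 - tau j)
        ell (x (tau j + k)%N) (nus j (x (tau j)) k))%:E)%E.

(* Asymptotic stability of the origin for the trajectories in [sol] that start
   in D: Lyapunov stability, and convergence from every point of D. *)
Definition asymptotically_stable (D : set state) (sol : set (nat -> state)) :=
  (forall e : R, 0 < e -> exists2 d : R, 0 < d &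
     forall x, sol x -> D (x 0%N) -> norm2 (x 0%N) < d ->
       forall t, norm2 (x t) < e) /\
  (forall x, sol x -> D (x 0%N) -> norm2 (x t) @[t --> \oo] --> (0 : R)).

(* Invariance of the region of attraction along the two kinds of trajectories
   to which the pointwise conditions [cost_controllable] and [relaxed_clf] on
   [roa] have to be applied. Neither follows from the definition of [roa], which
   refers to infinite-horizon optimal trajectories of the true system started
   at time 0. *)

Definition roa_predictions : Prop :=
  forall i y nu, (1 <= i)%N -> roa y -> optimal i fnom y nu ->
    forall k, (k <= i)%N -> roa (traj fnom y nu k).

Definition roa_updates (tau : nat -> nat)
    (nus : nat -> state -> nat -> input) : Prop :=
  forall x, closed_loop tau nus x -> roa (x 0%N) -> forall j, roa (x (tau j)).

(* LDe and LDb stand for L_Df(eps) and L_Df(epsbar). *)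

Definition mu_ce : R := 2 * ((eig_min (Qw p))^-1 + (eig_min (Rw p))^-1).

Definition zeta (Lf : R) (k : nat) : R :=
  mu_ce * \sum_(0 <= i < k) Lf ^+ (2 * i).

Definition zetabar (Lf LDb : R) (k : nat) : R :=
  mu_ce * \sum_(0 <= i < k) (Lf + LDb) ^+ (2 * i).

Definition delta (gbar : R) (gam : nat -> R) (kT : R) (N k : nat) : R :=
  (1 + gbar) * gam N * ((1 + kT) ^+ k - 1)
    / (1 + gbar + (N - k)%:R * (1 + kT) ^+ k).

Definition sigma1 (Lf : R) (N : nat) : R :=
  eig_max (Qw p) ^+ 2 / eig_min (Qw p) * \sum_(0 <= k < N) Lf ^+ (2 * k)
  + eig_max (Pw p) ^+ 2 / eig_min (Pw p) * Lf ^+ (2 * N).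

Definition sigma2 (Lf : R) (N : nat) : R :=
  eig_max (Qw p) * \sum_(0 <= k < N) Lf ^+ (2 * k)
  + eig_max (Pw p) * Lf ^+ (2 * N).

Definition alpha (Lf LDb LDe gbar : R) (gam : nat -> R) (kT : R) (N k : nat) : R :=
  2 * Num.sqrt (sigma1 Lf N * (gam N + delta gbar gam kT N k) * zetabar Lf LDb k)
    * LDe
  + sigma2 Lf N * zetabar Lf LDb k * LDe ^+ 2.

Definition beta (Lf LDe : R) (N : nat) : R :=
  2 * Num.sqrt
        (eig_max (Qw p) ^+ 2 / eig_min (Qw p) * \sum_(1 <= k < N) zeta Lf k
         + eig_max (Pw p) ^+ 2 / eig_min (Pw p) * zeta Lf N)
    * LDe
  + (eig_max (Qw p) * \sum_(1 <= k < N) zeta Lf k + eig_max (Pw p) * zeta Lf N)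
    * LDe ^+ 2.

Definition beta_oo (Lf LDe : R) : \bar R := limn (fun N => (beta Lf LDe N)%:E).

Definition theta (Lf LDb LDe : R) (k : nat) : R :=
  2 * eig_max (Qw p) / Num.sqrt (eig_min (Qw p))
    * Num.sqrt (\sum_(1 <= i < k) zetabar Lf LDb i) * LDe
  + eig_max (Qw p) * (\sum_(1 <= i < k) zetabar Lf LDb i) * LDe ^+ 2.

Definition gammabar_star (Lf LDe gbar : R) : \bar R :=
  (gbar%:E + beta_oo Lf LDe + gbar%:E * beta_oo Lf LDe)%E.

(* g / (1 + g), read as its limit 1 at +oo. *)
Definition gamma_ratio (g : \bar R) : R := if g is r%:E then r / (1 + r) else 1.

Definition rho (Lf LDb LDe gbar : R) (gam : nat -> R) (kT : R) (N M : nat) : R :=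
  delta gbar gam kT N M + alpha Lf LDb LDe gbar gam kT N M.

Definition Rstar (Lf LDb LDe gbar : R) (gam : nat -> R) (kT : R) (N M : nat) : R :=
  (1 + Num.min gbar (beta Lf LDe N)) * (1 + theta Lf LDb LDe M)
    / (1 - rho Lf LDb LDe gbar gam kT N M)
  * (1 + eig_max (Pw p) / eig_min (Qw p)
         * gamma_ratio (gammabar_star Lf LDe gbar) ^+ N).

End Plant.

(* Main.v *)
(* The state predicted by the nominal model and the true state driven by the same
   inputs drift apart by at most a multiple of L_Df(eps) times the square root of
   the predicted stage cost (Cauchy-Schwarz on the error recursion), and
   perturbing trajectories inside quadratic costs changes these by a cross term
   and a square term; this gives alpha, beta and theta. Combined with the decrease
   of V_N along nominal predictions, V_N drops between consecutive updates by at
   least (1 - rho) times the predicted stage cost, and telescoping bounds the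
   performance, and every state norm, by V_N at the initial state.

   It remains to compare V_N with V_oo. The sequence zeta_k is bounded below by a
   positive constant, so beta_oo is +oo unless L_Df(eps) = 0: either the ratio
   g / (1 + g), g = gammabar_star, is 1 and the bound is immediate, or the model is
   exact. In the second case the tail of the optimal cost decays geometrically
   because V_oo <= (1 + gammabar) l*, which follows by letting the horizon of
   nominal one-step MPC tend to infinity. *)

Require Import Defs.
From HB Require Import structures.
From mathcomp Require Import all_boot all_order all_algebra.
From mathcomp Require Import all_classical all_reals all_analysis.
From mathcomp Require Import zify ring lra.
Import Order.TTheory GRing.Theory Num.Theory.
Import numFieldNormedType.Exports.
Local Open Scope classical_set_scope.
Local Open Scope ring_scope.

Set Implicit Arguments.
Unset Strict Implicit.
Unset Printing Implicit Defensive.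

(** * Elementary real inequalities and the squared error recursion *)

Section RealInequalities.
Context {R : realType}.
Implicit Types x y z a b c d : R.

(** AM-GM in the form suited to cross terms: [(y - z) ^+ 2 >= 0] gives
    [4 * (y * z) <= (y + z) ^+ 2]. *)
Lemma amgm x y z : 0 <= y -> 0 <= z -> x ^+ 2 <= y * z -> 2 * x <= y + z.
Proof.
move=> y0 z0 h; have [x0|x0] := leP x 0; first by lra.
rewrite -(@ler_pXn2r _ 2) ?nnegrE; [|by []|by lra|by lra].
have : 0 <= (y - z) ^+ 2 by exact: sqr_ge0.
rewrite !expr2 in h *; nra.
Qed.

(** For [c > 0] the polynomial is evaluated at its minimizer [- b / c]; for [c = 0] a nonnegative
    affine function has slope zero. *)
Lemma discriminant_le0 a b c : 0 <= c ->
  (forall t, 0 <= a + 2 * t * b + t ^+ 2 * c) -> b ^+ 2 <= a * c.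
Proof.
rewrite le_eqVlt => /predU1P[<-|c0] h.
- have [->|bn] := eqVneq b 0; first by rewrite expr0n mulr0.
  (* This [t] would give the value -1. *)
  have := h (- (a + 1) / (2 * b)).
  have -> : a + 2 * (- (a + 1) / (2 * b)) * b + (- (a + 1) / (2 * b)) ^+ 2 * 0 = -1.
    by field.
  by lra.
- have := h (- b / c).
  have -> : a + 2 * (- b / c) * b + (- b / c) ^+ 2 * c = (a * c - b ^+ 2) / c.
    by field; lra.
  by rewrite pmulr_lge0 ?invr_gt0 // subr_ge0.
Qed.

Lemma sum_cauchy_schwarz (s : seq nat) (f g : nat -> R) :
  (\sum_(i <- s) f i * g i) ^+ 2
    <= (\sum_(i <- s) f i ^+ 2) * (\sum_(i <- s) g i ^+ 2).
Proof.
apply: discriminant_le0 => [|t]; first by apply: sumr_ge0 => i _; exact: sqr_ge0.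
rewrite !mulr_sumr -!big_split /=; apply: sumr_ge0 => i _.
suff -> : f i ^+ 2 + 2 * t * (f i * g i) + t ^+ 2 * g i ^+ 2 = (f i + t * g i) ^+ 2.
  exact: sqr_ge0.
by ring.
Qed.

(** Unrolling gives [e k <= d * \sum_i a ^+ (k - 1 - i) * h i], to which Cauchy-Schwarz applies. The
    induction does both at once, on the squares. *)
Lemma recursive_error_bound (e h l : nat -> R) a d n :
  0 <= a -> 0 <= d -> e 0%N = 0 ->
  (forall k, 0 <= e k) -> (forall k, 0 <= h k) ->
  (forall k, (k < n)%N -> e k.+1 <= a * e k + d * h k) ->
  (forall k, (k < n)%N -> h k ^+ 2 <= l k) ->
  forall k, (k <= n)%N ->
    e k ^+ 2 <= (\sum_(0 <= i < k) a ^+ (2 * i)) * d ^+ 2 * \sum_(0 <= i < k) l i.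
Proof.
move=> a0 d0 e0 ep hp he hl; elim=> [_|k IH kn].
  by rewrite e0 !big_geq // expr0n mulr0.
have {}IH := IH (ltnW kn); have {}he := he k kn.
rewrite big_nat_recl // (big_nat_recr k) //=.
under eq_bigr do rewrite mulnS exprD.
rewrite -mulr_sumr muln0 expr0.
set A := \sum_(0 <= i < k) a ^+ (2 * i) in IH *.
have A0 : 0 <= A by apply: sumr_ge0 => i _; exact: exprn_ge0.
set H := \sum_(0 <= i < k) l i in IH *.
have H0 : 0 <= H.
  rewrite /H big_nat_cond; apply: sumr_ge0 => i /andP[/andP[_ ik] _].
  by apply: le_trans (hl i (ltn_trans ik kn)); exact: sqr_ge0.
have {}hl := hl k kn.
have l0 : 0 <= l k by apply: le_trans hl; exact: sqr_ge0.
have : e k.+1 ^+ 2 <= (a * e k + d * h k) ^+ 2.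
  by rewrite ler_pXn2r ?nnegrE //; apply: addr_ge0; apply: mulr_ge0.
move/le_trans; apply.
have d2 : 0 <= d ^+ 2 by exact: sqr_ge0.
have a2 : 0 <= a ^+ 2 by exact: sqr_ge0.
have h2 : 0 <= h k ^+ 2 by exact: sqr_ge0.
(* The right-hand side collects the products of 1 with [H] and of [a ^+ 2 * A] with [l k] in the
   target [(1 + a ^+ 2 * A) * d ^+ 2 * (H + l k)]; the other two products absorb the squares. *)
have cross : 2 * (a * e k * (d * h k))
    <= d ^+ 2 * H + d ^+ 2 * (a ^+ 2 * A * l k).
  apply: amgm; [by rewrite mulr_ge0|by rewrite !mulr_ge0|].
  have -> : (a * e k * (d * h k)) ^+ 2 = a ^+ 2 * d ^+ 2 * (e k ^+ 2 * h k ^+ 2) by ring.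
  have -> : d ^+ 2 * H * (d ^+ 2 * (a ^+ 2 * A * l k))
    = a ^+ 2 * d ^+ 2 * (A * d ^+ 2 * H * l k) by ring.
  by apply: ler_wpM2l; [rewrite mulr_ge0|apply: ler_pM => //; exact: sqr_ge0].
have e2 : a ^+ 2 * e k ^+ 2 <= a ^+ 2 * (A * d ^+ 2 * H) by exact: ler_wpM2l.
have dl : d ^+ 2 * h k ^+ 2 <= d ^+ 2 * l k by exact: ler_wpM2l.
lra.
Qed.

End RealInequalities.

(** * Quadratic forms, their Cauchy-Schwarz inequality and the Euclidean norm *)

Section QuadraticForms.
Context {R : realType} {n : nat}.
Implicit Types (S : 'M[R]_n) (x y : 'cV[R]_n).

Definition bform S x y : R := (x^T *m S *m y) 0 0.

Lemma qformE S x : qform S x = bform S x x.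
Proof. by []. Qed.

Lemma bformDl S x y z : bform S (x + y) z = bform S x z + bform S y z.
Proof. by rewrite /bform linearD /= !mulmxDl mxE. Qed.

Lemma bformDr S x y z : bform S z (x + y) = bform S z x + bform S z y.
Proof. by rewrite /bform mulmxDr mxE. Qed.

Lemma bformZl S a x y : bform S (a *: x) y = a * bform S x y.
Proof. by rewrite /bform linearZ /= -!scalemxAl mxE. Qed.

Lemma bformZr S a x y : bform S y (a *: x) = a * bform S y x.
Proof. by rewrite /bform -!scalemxAr mxE. Qed.

Lemma bformC S x y : S^T = S -> bform S x y = bform S y x.
Proof.
move=> sS; rewrite /bform -[in LHS](trmxK (x^T *m S *m y)) [LHS]mxE.
by rewrite !trmx_mul trmxK sS mulmxA.
Qed.

Lemma qformD S x y : S^T = S ->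
  qform S (x + y) = qform S x + 2 * bform S x y + qform S y.
Proof.
by move=> sS; rewrite !qformE bformDl !bformDr (bformC y x sS); ring.
Qed.

Lemma qformZ S a x : qform S (a *: x) = a ^+ 2 * qform S x.
Proof. by rewrite !qformE bformZl bformZr mulrA. Qed.

Lemma qformN S x : qform S (- x) = qform S x.
Proof. by rewrite -scaleN1r qformZ sqrrN expr1n mul1r. Qed.

Lemma qform0 S : qform S 0 = 0.
Proof. by rewrite /qform mulmx0 mxE. Qed.

Lemma qform_cauchy_schwarz S x y : S^T = S -> (forall z, 0 <= qform S z) ->
  bform S x y ^+ 2 <= qform S x * qform S y.
Proof.
move=> sS pS; apply: discriminant_le0 => // t.
have -> : 2 * t * bform S x y = 2 * bform S x (t *: y) by rewrite bformZr; ring.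
by rewrite -qformZ -qformD.
Qed.

Lemma norm2_sqr x : norm2 x ^+ 2 = qform 1%:M x.
Proof.
rewrite /norm2 sqr_sqrtr /qform ?mulmx1 //.
by rewrite mxE; apply: sumr_ge0 => i _; rewrite mxE -expr2 sqr_ge0.
Qed.

Lemma norm2_ge0 x : 0 <= norm2 x.
Proof. exact: sqrtr_ge0. Qed.

Lemma qform1_ge0 x : 0 <= qform 1%:M x.
Proof. by rewrite -norm2_sqr sqr_ge0. Qed.

Lemma norm2N x : norm2 (- x) = norm2 x.
Proof. by apply/eqP; rewrite -(@eqrXn2 _ 2) ?norm2_ge0 // !norm2_sqr qformN. Qed.

Lemma norm2_0 : norm2 (0 : 'cV[R]_n) = 0.
Proof. by apply/eqP; rewrite -sqrf_eq0 norm2_sqr qform0. Qed.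

Lemma norm2_eq0 x : (norm2 x == 0) = (x == 0).
Proof.
apply/idP/eqP => [|->]; last by rewrite norm2_0.
rewrite -sqrf_eq0 norm2_sqr /qform mulmx1 mxE psumr_eq0; last first.
  by move=> i _; rewrite mxE -expr2 sqr_ge0.
move=> /allP h; apply/colP => i; rewrite mxE; apply/eqP.
by have := h i (mem_index_enum i); rewrite implyTb mxE -expr2 sqrf_eq0.
Qed.

Lemma ler_norm2D x y : norm2 (x + y) <= norm2 x + norm2 y.
Proof.
rewrite -(@ler_pXn2r _ 2) ?nnegrE ?addr_ge0 ?norm2_ge0 //.
rewrite norm2_sqr qformD ?trmx1 // -!norm2_sqr.
suff : bform 1%:M x y <= norm2 x * norm2 y by lra.
apply: le_trans (ler_norm _) _.
rewrite -(@ler_pXn2r _ 2) ?nnegrE ?mulr_ge0 ?norm2_ge0 // real_normK ?num_real //.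
by rewrite exprMn !norm2_sqr qform_cauchy_schwarz ?trmx1 //; exact: qform1_ge0.
Qed.

(** A crude bound for places where some finite constant is enough: the inverse in the coercivity
    lemma, and the existence of an upper bound for the Rayleigh quotient. *)
Lemma qform_le_entries S x :
  qform S x <= (\sum_i \sum_j `|S i j|) * norm2 x ^+ 2.
Proof.
have xi i : `|x i 0| <= norm2 x.
  rewrite -(@ler_pXn2r _ 2) ?nnegrE ?norm2_ge0 // real_normK ?num_real //.
  rewrite norm2_sqr /qform mulmx1 mxE (bigD1 i) //= mxE -expr2 lerDl.
  by apply: sumr_ge0 => j _; rewrite mxE -expr2 sqr_ge0.
rewrite /qform mxE exchange_big /= mulr_suml; apply: ler_sum => j _.
rewrite mxE !mulr_suml; apply: ler_sum => i _; rewrite mxE.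
apply: le_trans (ler_norm _) _; rewrite !normrM.
have -> : `|x i 0| * `|S i j| * `|x j 0| = `|S i j| * (`|x i 0| * `|x j 0|) by ring.
by rewrite expr2 ler_wpM2l // ler_pM.
Qed.

End QuadraticForms.

(** * Extreme eigenvalues as bounds of the Rayleigh quotient *)

Section Rayleigh.
Context {R : realType} {n : nat}.
Implicit Types (S : 'M[R]_n) (x y : 'cV[R]_n).

Lemma qformB S1 S2 x : qform (S1 - S2) x = qform S1 x - qform S2 x.
Proof. by rewrite /qform mulmxBr mulmxBl !mxE. Qed.

Lemma qformNl S x : qform (- S) x = - qform S x.
Proof. by rewrite /qform mulmxN mulNmx mxE. Qed.

Lemma qform_scalar (a : R) x : qform a%:M x = a * norm2 x ^+ 2.
Proof.
by rewrite norm2_sqr /qform -!mulmxA !mul_scalar_mx scale1r -scalemxAr mxE.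
Qed.

(* [|x|^4 = <A^-1 x, x>_A^2] and Cauchy-Schwarz for the form [A]. *)
Lemma invertible_psd_coercive S : S^T = S -> (forall x, 0 <= qform S x) ->
  S \in unitmx -> exists2 eta : R, 0 < eta & forall x, eta * norm2 x ^+ 2 <= qform S x.
Proof.
(* [K] bounds the form of the inverse; the summand 1 keeps it positive. *)
move=> sS pS uS; pose K := 1 + \sum_i \sum_j `|invmx S i j|.
have K0 : 0 < K by rewrite ltr_pwDl // !sumr_ge0 // => i _; exact: sumr_ge0.
exists K^-1 => [|x]; first by rewrite invr_gt0.
rewrite ler_pdivrMl //.
have [x0|x0] := eqVneq (norm2 x) 0; first by rewrite x0 expr0n mulr_ge0 // ltW.
have x2 : 0 < norm2 x ^+ 2 by rewrite exprn_gt0 // lt_def x0 norm2_ge0.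
have := qform_cauchy_schwarz (invmx S *m x) x sS pS.
have -> : bform S (invmx S *m x) x = norm2 x ^+ 2.
  by rewrite bformC // /bform mulmxA mulmxK // norm2_sqr /qform mulmx1.
have -> : qform S (invmx S *m x) = qform (invmx S) x.
  by rewrite /qform trmx_mul trmx_inv sS mulmxKV // mulmxA.
have := qform_le_entries (invmx S) x; set B := \sum_i _ => h1 h2.
have h3 : qform (invmx S) x <= K * norm2 x ^+ 2.
  by apply: le_trans h1 _; rewrite ler_wpM2r ?sqr_ge0 // lerDr.
rewrite -(@ler_pM2l _ (norm2 x ^+ 2)) // -expr2; apply: le_trans h2 _.
rewrite mulrA [norm2 x ^+ 2 * K]mulrC.
by rewrite ler_wpM2r.
Qed.

(** Library eigenvectors are rows, [v *m S = a *: v], hence the transposed witness. *)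
Lemma eigenvalue_qform S a : S^T = S -> eigenvalue S a ->
  exists2 x, x != 0 & qform S x = a * norm2 x ^+ 2.
Proof.
move=> sS /eigenvalueP[v vS v0]; exists v^T.
  by apply: contra v0 => /eqP h; rewrite -(trmxK v) h linear0.
by rewrite /qform trmxK vS -scalemxAl norm2_sqr /qform trmxK mulmx1 mxE.
Qed.

Lemma norm2_gt0 x : x != 0 -> 0 < norm2 x.
Proof. by rewrite -norm2_eq0 => h; rewrite lt_def h norm2_ge0. Qed.

Context (n0 : (0 < n)%N).

Lemma nonzero_vector : exists x, x != 0.
Proof.
exists (const_mx 1); apply/eqP => /colP /(_ (Ordinal n0)); rewrite !mxE.
by move/eqP; rewrite oner_eq0.
Qed.

(* The largest eigenvalue is the least [a] with [a I - S >= 0]: at that [a] the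
   matrix [a I - S] is singular, for otherwise it would be coercive. *)
Lemma rayleigh_max S : S^T = S ->
  eigenvalue S (eig_max S) /\ forall x, qform S x <= eig_max S * norm2 x ^+ 2.
Proof.
move=> sS; pose E := [set a : R | forall x, qform S x <= a * norm2 x ^+ 2].
have E0 : E !=set0 by exists (\sum_i \sum_j `|S i j|) => x; exact: qform_le_entries.
have [z z0] := nonzero_vector.
have lbE x a : x != 0 -> E a -> qform S x / norm2 x ^+ 2 <= a.
  by move=> x0 Ea; rewrite ler_pdivrMr ?exprn_gt0 ?norm2_gt0.
have hE : has_inf E.
  by split=> //; exists (qform S z / norm2 z ^+ 2) => a; exact: lbE.
have cE : E (inf E).
  move=> x; have [->|x0] := eqVneq x 0; first by rewrite qform0 norm2_0 expr0n mulr0.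
  rewrite -ler_pdivrMr ?exprn_gt0 ?norm2_gt0 //.
  by apply: lb_le_inf => // a; exact: lbE.
have eE : eigenvalue S (inf E).
  have sE : ((inf E)%:M - S)^T = (inf E)%:M - S by rewrite linearB /= tr_scalar_mx sS.
  have pE x : 0 <= qform ((inf E)%:M - S) x.
    by rewrite qformB qform_scalar subr_ge0; exact: cE.
  have [/(invertible_psd_coercive sE pE)[eta eta0 h]|nu] :=
      boolP ((inf E)%:M - S \in unitmx).
    (* Coercivity with constant [eta] would put [inf E - eta] into [E]. *)
    have : E (inf E - eta).
      by move=> x; have := h x; rewrite qformB qform_scalar; lra.
    by move=> /(ge_inf hE.2); lra.
  rewrite /eigenvalue /eigenspace kermx_eq0.
  apply: contra nu; rewrite row_free_unit => uS.
  by rewrite -opprB -scaleN1r unitmxZ ?unitrN1.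
have ubE a : eigenvalue S a -> a <= inf E.
  move=> /(eigenvalue_qform sS)[x x0 xa].
  have x2 : 0 < norm2 x ^+ 2 by rewrite exprn_gt0 // norm2_gt0.
  by have := cE x; rewrite xa ler_pM2r.
suff -> : eig_max S = inf E by [].
apply/eqP; rewrite eq_le; apply/andP; split.
  by apply: ge_sup; [exists (inf E)|].
by apply: ub_le_sup => //; exists (inf E).
Qed.

(** Negating the matrix reverses the spectrum, which reduces the lower Rayleigh bound to the upper
    one. *)
Lemma eig_minE S : eig_min S = - eig_max (- S).
Proof.
rewrite /eig_min /eig_max /inf; congr (- sup _).
apply/seteqP; split=> a /=.
  case=> b /eigenvalueP[v vS v0] <-; apply/eigenvalueP; exists v => //.
  by rewrite mulmxN vS scaleNr.
move=> /eigenvalueP[v vS v0]; exists (- a); rewrite ?opprK //.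
by apply/eigenvalueP; exists v => //; rewrite scaleNr -vS mulmxN opprK.
Qed.

Lemma rayleigh_min S : S^T = S ->
  eigenvalue S (eig_min S) /\ forall x, eig_min S * norm2 x ^+ 2 <= qform S x.
Proof.
move=> sS; have sN : (- S)^T = - S by rewrite linearN /= sS.
have [/eigenvalueP[v vS v0] h] := rayleigh_max sN; split=> [|x]; rewrite eig_minE.
  by apply/eigenvalueP; exists v => //; rewrite scaleNr -vS mulmxN opprK.
by have := h x; rewrite qformNl; lra.
Qed.

Lemma eig_min_gt0 S : posdef S -> 0 < eig_min S.
Proof.
case=> sS pS; have [/(eigenvalue_qform sS)[x x0 h] _] := rayleigh_min sS.
by have := pS x x0; rewrite h pmulr_lgt0 // exprn_gt0 // norm2_gt0.
Qed.

Lemma eig_min_le_max S : S^T = S -> eig_min S <= eig_max S.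
Proof.
move=> sS; have [x x0] := nonzero_vector.
have x2 : 0 < norm2 x ^+ 2 by rewrite exprn_gt0 // norm2_gt0.
rewrite -(ler_pM2r x2).
exact: le_trans ((rayleigh_min sS).2 x) ((rayleigh_max sS).2 x).
Qed.

Lemma posdef_qform_ge0 S x : posdef S -> 0 <= qform S x.
Proof.
case=> _ pS; have [->|x0] := eqVneq x 0; first by rewrite qform0.
exact/ltW/pS.
Qed.

Lemma eig_max_gt0 S : posdef S -> 0 < eig_max S.
Proof.
by move=> pS; apply: lt_le_trans (eig_min_gt0 pS) (eig_min_le_max pS.1).
Qed.

(** Cauchy-Schwarz gives the factor [eig_max S]. As [eig_min S <= eig_max S], it can be enlarged to
    the quotient that occurs in [sigma1] and [beta], and through its square root in [theta]. *)
Lemma bform_le_eig S x d : posdef S ->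
  bform S x d ^+ 2 <= qform S x * (eig_max S ^+ 2 / eig_min S * norm2 d ^+ 2).
Proof.
move=> pS; have q0 y := posdef_qform_ge0 y pS.
apply: le_trans (qform_cauchy_schwarz x d pS.1 q0) _.
apply: ler_wpM2l => //; apply: le_trans ((rayleigh_max pS.1).2 d) _.
rewrite ler_wpM2r ?sqr_ge0 // expr2 -mulrA ler_peMr //; first exact/ltW/eig_max_gt0.
by rewrite ler_pdivlMr ?eig_min_gt0 // mul1r eig_min_le_max // pS.1.
Qed.

End Rayleigh.

(* Cauchy-Schwarz, first in each form [S k] and then over [k]. *)
Lemma sum_qform_perturbation {R : realType} (n : nat) (S : nat -> 'M[R]_n)
    (y z : nat -> 'cV[R]_n) (w : nat -> R) (E : R) (N : nat) :
  (0 < n)%N -> 0 <= E -> (forall k, posdef (S k)) -> (forall k, 0 <= w k) ->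
  (forall k, (k < N)%N -> norm2 (y k - z k) ^+ 2 <= w k * E) ->
  \sum_(0 <= k < N) qform (S k) (y k) <=
    \sum_(0 <= k < N) qform (S k) (z k)
    + 2 * Num.sqrt ((\sum_(0 <= k < N) qform (S k) (z k)) * 
        (E * \sum_(0 <= k < N) eig_max (S k) ^+ 2 / eig_min (S k) * w k))
    + E * \sum_(0 <= k < N) eig_max (S k) * w k.
Proof.
move=> n0 E0 pS w0 h; set Z := \sum_(0 <= k < N) qform (S k) (z k).
pose c k := eig_max (S k) ^+ 2 / eig_min (S k).
have c0 k : 0 <= c k by rewrite divr_ge0 ?sqr_ge0 // ltW // eig_min_gt0.
have cwE0 k : 0 <= c k * (w k * E) by apply: mulr_ge0 => //; exact: mulr_ge0.
have q0 k v : 0 <= qform (S k) v by exact: posdef_qform_ge0.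
pose f k := Num.sqrt (qform (S k) (z k)).
pose g k := Num.sqrt (c k * (w k * E)).
have step k : (k < N)%N -> qform (S k) (y k)
    <= qform (S k) (z k) + 2 * (f k * g k) + E * (eig_max (S k) * w k).
  move=> kN; set d := y k - z k; have -> : y k = z k + d by rewrite addrC subrK.
  rewrite qformD; last exact: (pS k).1.
  have dE : norm2 d ^+ 2 <= w k * E by exact: h.
  have b : bform (S k) (z k) d <= f k * g k.
    apply: le_trans (ler_norm _) _.
    rewrite -(@ler_pXn2r _ 2) ?nnegrE ?mulr_ge0 ?sqrtr_ge0 // real_normK ?num_real //.
    rewrite exprMn /f /g !sqr_sqrtr //; apply: le_trans (bform_le_eig n0 (z k) d (pS k)) _.
    by apply: ler_wpM2l => //; apply: ler_wpM2l => //; exact: c0.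
  have q : qform (S k) d <= E * (eig_max (S k) * w k).
    apply: le_trans ((rayleigh_max n0 (pS k).1).2 d) _.
    have -> : E * (eig_max (S k) * w k) = eig_max (S k) * (w k * E) by ring.
    by rewrite ler_wpM2l // ltW // eig_max_gt0.
  lra.
have : \sum_(0 <= k < N) qform (S k) (y k) <= \sum_(0 <= k < N)
    (qform (S k) (z k) + 2 * (f k * g k) + E * (eig_max (S k) * w k)).
  by rewrite !big_mkord; apply: ler_sum => k _; exact: step.
move/le_trans; apply; rewrite !big_split /= -!mulr_sumr lerD2r lerD2l ler_pM2l //.
apply: le_trans (ler_norm _) _.
rewrite -(@ler_pXn2r _ 2) ?nnegrE ?sqrtr_ge0 // real_normK ?num_real //.
have Z0 : 0 <= Z by apply: sumr_ge0.
rewrite sqr_sqrtr; last first.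
  by rewrite !mulr_ge0 // sumr_ge0 // => k _; rewrite mulr_ge0 // c0.
apply: le_trans (sum_cauchy_schwarz _ _ _) _.
rewrite le_eqVlt; apply/orP; left; apply/eqP; congr (_ * _).
  by apply: eq_bigr => k _; rewrite /f sqr_sqrtr.
by rewrite mulr_sumr; apply: eq_bigr => k _; rewrite /g sqr_sqrtr // /c; ring.
Qed.

(** * Trajectories, concatenated inputs and basic cost bounds *)

Section Trajectories.
Context {R : realType} {n m : nat} (p : plant R n m).
Local Notation state := 'cV[R]_n.
Local Notation input := 'cV[R]_m.
Implicit Types (x : state) (nu : nat -> input) (F : nat -> state -> input -> state).

Lemma eq_traj F x nu nu' k : (forall i, (i < k)%N -> nu i = nu' i) ->
  traj F x nu k = traj F x nu' k.
Proof.
elim: k => //= k IH h; rewrite IH => [|i ik]; first by rewrite h.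
by apply: h; exact: ltnW.
Qed.

(** Restarting is possible because [fnom] ignores the time index; general dynamics would have to be
    shifted as well. *)
Lemma traj_add x nu i k : traj (fnom p) x nu (i + k) =
  traj (fnom p) (traj (fnom p) x nu i) (fun j => nu (i + j)%N) k.
Proof. by elim: k => [|k IH]; rewrite ?addn0 // addnS /= IH. Qed.

Definition glue i nu nu' : nat -> input :=
  fun k => if (k < i)%N then nu k else nu' (k - i)%N.

Lemma glue_lt i nu nu' k : (k < i)%N -> glue i nu nu' k = nu k.
Proof. by rewrite /glue => ->. Qed.

Lemma glue_add i nu nu' k : glue i nu nu' (i + k)%N = nu' k.
Proof. by rewrite /glue ltnNge leq_addr /= addKn. Qed.

Lemma traj_glue_le F x i nu nu' k : (k <= i)%N ->
  traj F x (glue i nu nu') k = traj F x nu k.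
Proof. by move=> ki; apply: eq_traj => j jk; rewrite glue_lt // (leq_trans jk). Qed.

Lemma traj_glue_add x i nu nu' k : traj (fnom p) x (glue i nu nu') (i + k) =
  traj (fnom p) (traj (fnom p) x nu i) nu' k.
Proof.
rewrite traj_add traj_glue_le //; apply: eq_traj => j _; exact: glue_add.
Qed.

Definition stage_cost F x nu k : R := ell p (traj F x nu k) (nu k).

Lemma costE N F x nu : cost p N F x nu =
  \sum_(0 <= k < N) stage_cost F x nu k + ellT p (traj F x nu N).
Proof. by []. Qed.

Lemma sum_stage_cost_shift x nu i j :
  \sum_(0 <= k < j) stage_cost (fnom p) (traj (fnom p) x nu i) (fun l => nu (i + l)%N) k
  = \sum_(i <= k < i + j) stage_cost (fnom p) x nu k.
Proof.
rewrite -[X in _ = \sum_(X <= _ < _) _]add0n [(i + j)%N]addnC big_addn addnK.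
by apply: eq_bigr => k _; rewrite /stage_cost -traj_add addnC.
Qed.

Lemma sum_stage_cost_glue_le F x nu nu' i j : (j <= i)%N ->
  \sum_(0 <= k < j) stage_cost F x (glue i nu nu') k
  = \sum_(0 <= k < j) stage_cost F x nu k.
Proof.
move=> ji; rewrite !big_mkord; apply: eq_bigr => k _.
have ki : (k < i)%N by apply: leq_trans (ltn_ord k) ji.
by rewrite /stage_cost traj_glue_le ?glue_lt // ltnW.
Qed.

Lemma sum_stage_cost_glue x nu nu' i j :
  \sum_(0 <= k < i + j) stage_cost (fnom p) x (glue i nu nu') k
  = \sum_(0 <= k < i) stage_cost (fnom p) x nu k
    + \sum_(0 <= k < j) stage_cost (fnom p) (traj (fnom p) x nu i) nu' k.
Proof.
rewrite (@big_cat_nat _ _ _ i) ?leq_addr //= sum_stage_cost_glue_le //; congr (_ + _).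
rewrite -sum_stage_cost_shift traj_glue_le //; apply: eq_bigr => k _.
by rewrite /stage_cost; under eq_traj do rewrite glue_add; rewrite glue_add.
Qed.

Lemma cost_glue x nu nu' i j :
  cost p (i + j) (fnom p) x (glue i nu nu')
  = \sum_(0 <= k < i) stage_cost (fnom p) x nu k
    + cost p j (fnom p) (traj (fnom p) x nu i) nu'.
Proof. by rewrite !costE sum_stage_cost_glue traj_glue_add addrA. Qed.

Context (n0 : (0 < n)%N) (m0 : (0 < m)%N) (hp : standing p).

Lemma posdef_Qw : posdef (Qw p). Proof. by case: hp. Qed.

Lemma posdef_Rw : posdef (Rw p). Proof. by case: hp. Qed.

Lemma qform_Qw_le_ellT x : qform (Qw p) x <= ellT p x.
Proof. by case: hp => _ _ _ [_ _ h]; have := h x; rewrite qformB subr_ge0. Qed.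

Lemma posdef_Pw : posdef (Pw p).
Proof.
split=> [|x x0]; first by case: hp => _ _ _ [].
exact: lt_le_trans (posdef_Qw.2 x x0) (qform_Qw_le_ellT x).
Qed.

Lemma qform_Qw_ge0 x : 0 <= qform (Qw p) x.
Proof. exact: (posdef_qform_ge0 _ posdef_Qw). Qed.

Lemma ellT_ge0 x : 0 <= ellT p x.
Proof. exact: (posdef_qform_ge0 _ posdef_Pw). Qed.

Lemma qform_le_ell x u : qform (Qw p) x <= ell p x u.
Proof. by rewrite /ell lerDl; exact: (posdef_qform_ge0 _ posdef_Rw). Qed.

Lemma ell_ge0 x u : 0 <= ell p x u.
Proof. exact: le_trans (qform_Qw_ge0 x) (qform_le_ell x u). Qed.

Lemma stage_cost_ge0 F x nu k : 0 <= stage_cost F x nu k.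
Proof. exact: ell_ge0. Qed.

Lemma cost_ge0 N F x nu : 0 <= cost p N F x nu.
Proof. by rewrite costE addr_ge0 ?ellT_ge0 // sumr_ge0 // => k _; exact: ell_ge0. Qed.

Lemma mu_ce_ge0 : 0 <= mu_ce p.
Proof.
rewrite mulr_ge0 // addr_ge0 // invr_ge0 ltW //; apply: eig_min_gt0 => //.
  exact: posdef_Qw.
exact: posdef_Rw.
Qed.

(** The weights bound both norms by parts of the stage cost, and
    [(s + t) ^+ 2 <= 2 * (s ^+ 2 + t ^+ 2)] is the origin of the factor 2 in [mu_ce]. *)
Lemma norms_le_ell x u : (norm2 x + norm2 u) ^+ 2 <= mu_ce p * ell p x u.
Proof.
have q0 := eig_min_gt0 n0 posdef_Qw; have r0 := eig_min_gt0 m0 posdef_Rw.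
have hx : norm2 x ^+ 2 <= (eig_min (Qw p))^-1 * qform (Qw p) x.
  by rewrite ler_pdivlMl //; exact: (rayleigh_min n0 posdef_Qw.1).2.
have hu : norm2 u ^+ 2 <= (eig_min (Rw p))^-1 * qform (Rw p) u.
  by rewrite ler_pdivlMl //; exact: (rayleigh_min m0 posdef_Rw.1).2.
have a0 : 0 <= (eig_min (Qw p))^-1 by rewrite invr_ge0 ltW.
have b0 : 0 <= (eig_min (Rw p))^-1 by rewrite invr_ge0 ltW.
have x0 := qform_Qw_ge0 x; have u0 := posdef_qform_ge0 u posdef_Rw.
have c1 : 0 <= (eig_min (Qw p))^-1 * qform (Rw p) u by exact: mulr_ge0.
have c2 : 0 <= (eig_min (Rw p))^-1 * qform (Qw p) x by exact: mulr_ge0.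
have sq : 0 <= (norm2 x - norm2 u) ^+ 2 by exact: sqr_ge0.
rewrite /mu_ce /ell; set a := (eig_min (Qw p))^-1 in hx a0 c1 *.
set b := (eig_min (Rw p))^-1 in hu b0 c2 *; lra.
Qed.

Context (U0 : inputs p 0).

(** The input cost is nonnegative and vanishes at the admissible input 0. *)
Lemma ell_starE x : ell_star p x = qform (Qw p) x.
Proof.
apply/eqP; rewrite eq_le; apply/andP; split.
  apply: ge_inf; first by exists 0 => _ [u _ <-]; exact: ell_ge0.
  by exists 0; rewrite // /ell qform0 addr0.
apply: lb_le_inf; first by exists (ell p x 0), 0.
by move=> _ [u _ <-]; exact: qform_le_ell.
Qed.

Lemma VN_le N F x nu : admissible p N nu -> VN p N F x <= cost p N F x nu.
Proof.
move=> h; apply: ge_inf; first by exists 0 => _ [u _ <-]; exact: cost_ge0.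
by exists nu.
Qed.

Lemma VN_optimal N F x nu : optimal p N F x nu -> VN p N F x = cost p N F x nu.
Proof.
case=> a h; apply/eqP; rewrite eq_le VN_le //=.
apply: lb_le_inf; first by exists (cost p N F x nu), nu.
by move=> _ [nu' a' <-]; exact: h.
Qed.

Lemma admissible_glue i j nu nu' : admissible p i nu -> admissible p j nu' ->
  admissible p (i + j) (glue i nu nu').
Proof.
move=> a a' k kij; rewrite /glue; case: ltnP => [|ik]; first exact: a.
by apply: a'; rewrite ltn_subLR.
Qed.

End Trajectories.

(** * The value function along nominal predictions *)

Section NominalDecrease.
Context {R : realType} {n m : nat} (p : plant R n m).
Context (hp : standing p) (U0 : inputs p 0).
Context (hopt : optimizers_exist p).
Context (gbar : R) (gam : nat -> R) (hcc : cost_controllable p gbar gam).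
Context (kT : R) (hT : relaxed_clf p kT) (hpred : roa_predictions p).
Local Notation f := (fnom p).
Local Notation V N := (VN p N f).
Implicit Types (x y : 'cV[R]_n) (nu : nat -> 'cV[R]_m).

(** One half of dynamic programming: after [i] steps of [nu], continue with an optimizer for horizon
    [j] at the state reached. *)
Lemma VN_concat x nu i j : (0 < j)%N -> admissible p i nu ->
  V (i + j) x <= \sum_(0 <= k < i) stage_cost p f x nu k + V j (traj f x nu i).
Proof.
move=> j0 a; case: hopt => _ /(_ j (traj f x nu i) j0) [nu' o] _.
rewrite (VN_optimal hp o) -cost_glue; apply: VN_le => //.
exact: admissible_glue o.1.
Qed.

Lemma VN_tail x nu i j : admissible p (i + j) nu ->
  V j (traj f x nu i)
    <= \sum_(i <= k < i + j) stage_cost p f x nu k + ellT p (traj f x nu (i + j)).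
Proof.
move=> a; rewrite -sum_stage_cost_shift traj_add -costE; apply: VN_le => // k kj.
by apply: a; rewrite ltn_add2l.
Qed.

(** A constant input on horizon 1 costs exactly the expression minimized in [relaxed_clf]. *)
Lemma V1_le x : roa p x -> V 1 x <= (1 + kT) * qform (Qw p) x.
Proof.
move=> rx; rewrite -(ell_starE hp U0); apply: le_trans (hT.2 x rx).
apply: lb_le_inf; first by exists (ellT p (nominal p x 0) + ell p x 0), 0.
move=> _ [u Uu <-].
have h : V 1 x <= cost p 1 f x (fun=> u) by exact: VN_le.
by apply: le_trans h _; rewrite /cost big_nat1 /= addrC.
Qed.

(** Append one step to an optimizer. The predicted end state lies in [roa], so [V1_le] applies
    there, and [P >= Q] bounds the result by [1 + kT] times the old terminal cost. *)
Lemma VN_step y i : (0 < i)%N -> roa p y -> V i.+1 y <= (1 + kT) * V i y.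
Proof.
move=> i0 ry; have k0 := hT.1.
case: hopt => _ /(_ i y i0) [nu o] _.
rewrite -addn1; apply: le_trans (VN_concat y (ltn0Sn 0) o.1) _.
have rz : roa p (traj f y nu i) by exact: (hpred i0 ry o).
have h1 := V1_le rz; have h2 := qform_Qw_le_ellT hp (traj f y nu i).
have h3 : (1 + kT) * qform (Qw p) (traj f y nu i) <= (1 + kT) * ellT p (traj f y nu i).
  by apply: ler_wpM2l => //; lra.
rewrite (VN_optimal hp o) costE.
have : 0 <= kT * \sum_(0 <= k < i) stage_cost p f y nu k.
  by rewrite mulr_ge0 // sumr_ge0 // => k _; exact: stage_cost_ge0.
lra.
Qed.

Lemma VN_growth y i l : (0 < i)%N -> roa p y -> V (i + l) y <= (1 + kT) ^+ l * V i y.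
Proof.
move=> i0 ry; elim: l => [|l IH]; first by rewrite addn0 mul1r.
rewrite addnS; apply: le_trans (VN_step _ ry) _; first by rewrite addn_gt0 i0.
by rewrite exprS -mulrA ler_wpM2l //; have := hT.1; lra.
Qed.

(** The step from the terminal cost to horizon 1 takes one factor [1 + kT]; the other [l - 1]
    factors come from [VN_growth]. *)
Lemma VN_le_ellT y l : (0 < l)%N -> roa p y -> V l y <= (1 + kT) ^+ l * ellT p y.
Proof.
case: l => // l _ ry; rewrite -add1n; apply: le_trans (VN_growth l _ ry) _ => //.
rewrite exprD expr1 [(1 + kT) * _]mulrC -mulrA.
have k1 : 0 <= 1 + kT by have := hT.1; lra.
apply: ler_wpM2l; first exact: exprn_ge0.
by apply: le_trans (V1_le ry) _; apply: ler_wpM2l => //; exact: qform_Qw_le_ellT.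
Qed.

Lemma VN_controllable i y : (0 < i)%N -> roa p y ->
  V i y <= (1 + gam i) * qform (Qw p) y.
Proof. by move=> i0 ry; rewrite -(ell_starE hp U0); apply: (hcc i0).2. Qed.

Lemma gam_gt0 i : (0 < i)%N -> 0 < gam i.
Proof. by move=> /hcc[/andP[]]. Qed.

Lemma gam_le i : (0 < i)%N -> gam i <= gbar.
Proof. by move=> /hcc[/andP[]]. Qed.

Lemma gbar_gt0 : 0 < gbar.
Proof. exact: lt_le_trans (gam_gt0 (ltn0Sn 0)) (gam_le (ltn0Sn 0)). Qed.

Lemma delta_den_gt0 N M : 0 < 1 + gbar + (N - M)%:R * (1 + kT) ^+ M.
Proof.
have := gbar_gt0; have k0 := hT.1.
have : 0 <= (N - M)%:R * (1 + kT) ^+ M by rewrite mulr_ge0 // exprn_ge0 //; lra.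
lra.
Qed.

Lemma delta_ge0 N M : (0 < N)%N -> 0 <= delta gbar gam kT N M.
Proof.
move=> N0; have k0 := hT.1; have g0 := gbar_gt0; have gN := gam_gt0 N0.
apply: divr_ge0; last exact/ltW/delta_den_gt0.
apply: mulr_ge0; first by apply: mulr_ge0; lra.
by rewrite subr_ge0 exprn_ege1 // lerDl.
Qed.

(* Let [D] be the excess of [V N] over the cost of the remaining prediction and
   [c = (1 + kT) ^+ M]. Following the prediction up to stage [i] and bounding the
   rest in two ways, by terminal growth and by cost controllability, gives
   [c * D <= (c - 1) * (1 + gbar) * l*(xi_i)] for [M <= i < N]; summing over [i]
   produces the denominator of [delta]. *)
Lemma nominal_decrease N M l x nu : (0 < l)%N -> (l <= M)%N -> (M < N)%N ->
  roa p x -> optimal p N f x nu ->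
  V N (traj f x nu l) <= \sum_(l <= k < N) stage_cost p f x nu k
    + ellT p (traj f x nu N) + delta gbar gam kT N M * qform (Qw p) x.
Proof.
move=> l0 lM MN rx o; have k0 := hT.1; have g0 := gbar_gt0.
have N0 : (0 < N)%N by exact: leq_trans MN.
pose T i := \sum_(i <= k < N) stage_cost p f x nu k + ellT p (traj f x nu N).
rewrite -/(T l); set D := V N (traj f x nu l) - T l.
suff : D <= delta gbar gam kT N M * qform (Qw p) x by rewrite /D; lra.
set c := (1 + kT) ^+ M; set z := traj f x nu.
have c1 : 1 <= c by rewrite exprn_ege1 // lerDl.
have cl : (1 + kT) ^+ l <= c by apply: ler_weXn2l => //; lra.
have rz i : (i <= N)%N -> roa p (z i) by move=> iN; exact: (hpred N0 rx o).
have lN : (l < N)%N by exact: leq_ltn_trans MN.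
(* Replaying the predicted inputs from stage [l] to [i] uses [i - l] steps of the horizon and leaves
   [N - i + l]. *)
have step i : (l <= i)%N -> (i <= N)%N -> D <= V (N - i + l) (z i) - T i.
  move=> li iN; rewrite /D lerBlDr.
  have -> : T l = \sum_(l <= k < i) stage_cost p f x nu k + T i.
    by rewrite /T addrA -big_cat_nat.
  have a : admissible p (i - l) (fun k => nu (l + k)%N).
    by move=> k ki; apply: o.1; rewrite -ltn_subRL; apply: leq_trans ki _; rewrite leq_sub2r.
  have j0 : (0 < N - i + l)%N by rewrite addn_gt0 l0 orbT.
  have := VN_concat (z l) j0 a.
  rewrite sum_stage_cost_shift -traj_add subnKC //.
  have -> : (i - l + (N - i + l) = N)%N by lia.
  rewrite -/z; lra.
have DT : D <= (c - 1) * ellT p (z N).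
  apply: le_trans (step N _ _) _ => //; first exact: ltnW.
  rewrite subnn add0n /T big_geq // add0r.
  have := VN_le_ellT l0 (rz N (leqnn _)).
  have : (1 + kT) ^+ l * ellT p (z N) <= c * ellT p (z N).
    by apply: ler_wpM2r => //; exact: ellT_ge0.
  rewrite -/z; lra.
have Di i : (M <= i)%N -> (i < N)%N ->
    c * D <= (c - 1) * ((1 + gbar) * qform (Qw p) (z i)).
  move=> Mi iN; have := step i (leq_trans lM Mi) (ltnW iN).
  have i0 : (0 < N - i)%N by rewrite subn_gt0.
  have ri := rz i (ltnW iN).
  have iNE : (i + (N - i) = N)%N by rewrite subnKC // ltnW.
  have := @VN_tail x nu i (N - i); rewrite iNE -/z => /(_ o.1) h1.
  have h2 := VN_growth l i0 ri.
  have h3 : V (N - i + l) (z i) <= (1 + gbar) * qform (Qw p) (z i).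
    apply: le_trans (VN_controllable _ ri) _; first by rewrite addn_gt0 i0.
    apply: ler_wpM2r; first exact: qform_Qw_ge0.
    by rewrite lerD2l gam_le // addn_gt0 i0.
  have T0 : 0 <= T i.
    rewrite addr_ge0 ?ellT_ge0 // sumr_ge0 // => k _; exact: stage_cost_ge0.
  have h4 : (1 + kT) ^+ l * V (N - i) (z i) <= c * T i.
    apply: le_trans (_ : (1 + kT) ^+ l * T i <= _).
      by apply: ler_wpM2l => //; apply: exprn_ge0; lra.
    exact: ler_wpM2r.
  rewrite -/z in h2; move=> hD.
  (* Terminal growth bounds [D] by [(c - 1) * T i], so [T i] can be eliminated from the
     controllability bound on [D + T i] once that is multiplied by [c - 1]. *)
  have e1 : D <= (c - 1) * T i by lra.
  have : (c - 1) * (D + T i) <= (c - 1) * ((1 + gbar) * qform (Qw p) (z i)).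
    by apply: ler_wpM2l; lra.
  lra.
(* Cost controllability at [x]: the 1 in [1 + gam N] is spent on the stage costs before [M], which
   dominate [qform (Qw p) x]. *)
have total : \sum_(M <= k < N) qform (Qw p) (z k) + ellT p (z N)
    <= gam N * qform (Qw p) x.
  have := VN_controllable N0 rx; rewrite (VN_optimal hp o) costE.
  rewrite (@big_cat_nat _ _ _ M) //=; last exact: ltnW.
  have : qform (Qw p) x <= \sum_(0 <= k < M) stage_cost p f x nu k.
    rewrite big_ltn ?(leq_trans l0) //; apply: le_trans (qform_le_ell hp x (nu 0%N)) _.
    by rewrite lerDl sumr_ge0 // => k _; exact: stage_cost_ge0.
  have : \sum_(M <= k < N) qform (Qw p) (z k)
      <= \sum_(M <= k < N) stage_cost p f x nu k.
    by apply: ler_sum => k _; exact: qform_le_ell.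
  rewrite -/z; lra.
have sumD : (N - M)%:R * (c * D)
    <= (c - 1) * (1 + gbar) * \sum_(M <= k < N) qform (Qw p) (z k).
  rewrite mulr_natl -sumr_const_nat mulr_sumr; apply: ler_sum_nat => k /andP[Mk kN].
  by rewrite -mulrA; exact: Di.
rewrite /delta -/c mulrAC ler_pdivlMr ?delta_den_gt0 //.
(* Adding [1 + gbar] copies of the terminal bound to the [N - M] stage bounds produces, up to a
   common factor, the left-hand side of [total]. *)
have DT2 : (1 + gbar) * D <= (1 + gbar) * ((c - 1) * ellT p (z N)).
  by apply: ler_wpM2l => //; lra.
have tot2 : (c - 1) * (1 + gbar) * (\sum_(M <= k < N) qform (Qw p) (z k) + ellT p (z N))
    <= (c - 1) * (1 + gbar) * (gam N * qform (Qw p) x).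
  by apply: ler_wpM2l => //; apply: mulr_ge0; lra.
rewrite -/c; lra.
Qed.

End NominalDecrease.

(** * Effect of the model mismatch on trajectories and costs *)

Section Perturbation.
Context {R : realType} {n m : nat} (p : plant R n m).
Context (n0 : (0 < n)%N) (m0 : (0 < m)%N) (hp : standing p).
Context (Lf e b : R) (Lf0 : 0 < Lf) (e0 : 0 <= e) (eb : e <= b).
Context (hLf : forall x x' u, inputs p u ->
  norm2 (nominal p x u - nominal p x' u) <= Lf * norm2 (x - x')).
Context (hmis : forall t x u, inputs p u ->
  norm2 (mismatch p t x u) <= e * (norm2 x + norm2 u)).
Local Notation f := (fnom p).
Implicit Types (x y z : 'cV[R]_n) (nu : nat -> 'cV[R]_m).

Lemma sum_pow_mono (a : R) i j : 0 <= a -> (i <= j)%N ->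
  \sum_(0 <= k < i) a ^+ (2 * k) <= \sum_(0 <= k < j) a ^+ (2 * k).
Proof.
move=> a0 ij; rewrite (@big_cat_nat _ _ _ i _ j) //= lerDl.
by rewrite sumr_ge0 // => k _; exact: exprn_ge0.
Qed.

Lemma Lfb_ge0 : 0 <= Lf + b.
Proof. by have := e0; have := eb; have := Lf0; lra. Qed.

Lemma zetabar_mono i j : (i <= j)%N -> zetabar p Lf b i <= zetabar p Lf b j.
Proof.
move=> ij; apply: ler_wpM2l; first exact: mu_ce_ge0.
exact: sum_pow_mono Lfb_ge0 ij.
Qed.

Lemma zetabar0 : zetabar p Lf b 0 = 0.
Proof. by rewrite /zetabar big_geq // mulr0. Qed.

Lemma zetabar_ge0 k : 0 <= zetabar p Lf b k.
Proof. by rewrite -zetabar0; exact: zetabar_mono. Qed.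

Lemma zeta0 : zeta p Lf 0 = 0.
Proof. by rewrite /zeta big_geq // mulr0. Qed.

Lemma zeta_ge0 k : 0 <= zeta p Lf k.
Proof.
apply: mulr_ge0; first exact: mu_ce_ge0.
by rewrite sumr_ge0 // => i _; apply/exprn_ge0/ltW.
Qed.

(** The mismatch acts at the true state, whose norm is at most that of the prediction plus the
    error. The error part raises the growth factor from [Lf] to [Lf + b], hence [zetabar]; the costs
    are those of the prediction. *)
Lemma plant_error_bound (xs : nat -> 'cV[R]_n) nu t N :
  admissible p N nu ->
  (forall k, (k < N)%N -> xs k.+1 = fstar p (t + k) (xs k) (nu k)) ->
  forall k, (k <= N)%N ->
  norm2 (xs k - traj f (xs 0%N) nu k) ^+ 2
    <= zetabar p Lf b k * e ^+ 2 * \sum_(0 <= i < k) stage_cost p f (xs 0%N) nu i.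
Proof.
move=> a hxs k kN; set z := traj f (xs 0%N) nu.
have := @recursive_error_bound R (fun k => norm2 (xs k - z k))
  (fun k => norm2 (z k) + norm2 (nu k)) (fun k => mu_ce p * stage_cost p f (xs 0%N) nu k)
  (Lf + b) e N Lfb_ge0 e0.
move=> h; rewrite /zetabar.
apply: le_trans (h _ _ _ _ _ _ kN) _;
  last by rewrite -mulr_sumr le_eqVlt; apply/orP; left; apply/eqP; ring.
- by rewrite subrr norm2_0.
- by move=> i; exact: norm2_ge0.
- by move=> i; rewrite addr_ge0 ?norm2_ge0.
- move=> i iN; rewrite hxs // /fstar /z /= -/z addrAC.
  apply: le_trans (ler_norm2D _ _) _.
  have h1 := hLf (xs i) (z i) (a i iN).
  have h2 := hmis (t + i) (xs i) (a i iN).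
  have h3 : norm2 (xs i) <= norm2 (xs i - z i) + norm2 (z i).
    by have := ler_norm2D (xs i - z i) (z i); rewrite subrK.
  have h4 : e * norm2 (xs i) <= e * (norm2 (xs i - z i) + norm2 (z i)).
    exact: ler_wpM2l.
  (* [e] is enlarged to [b] because [zetabar] is built from [b]. *)
  have h5 : e * norm2 (xs i - z i) <= b * norm2 (xs i - z i).
    by rewrite ler_wpM2r ?norm2_ge0.
  by rewrite /fnom; lra.
- by move=> i _; exact: norms_le_ell.
Qed.

(** Here the costs are taken along the true trajectory, where the mismatch is evaluated, so the
    growth factor stays [Lf] and [zeta] appears. *)
Lemma model_error_bound y nu N : admissible p N nu -> forall k, (k <= N)%N ->
  norm2 (traj f y nu k - traj (fstar p) y nu k) ^+ 2
    <= zeta p Lf k * e ^+ 2 * \sum_(0 <= i < k) stage_cost p (fstar p) y nu i.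
Proof.
move=> a k kN; set z := traj f y nu; set xs := traj (fstar p) y nu.
have := @recursive_error_bound R (fun k => norm2 (z k - xs k))
  (fun k => norm2 (xs k) + norm2 (nu k)) (fun k => mu_ce p * stage_cost p (fstar p) y nu k)
  Lf e N (ltW Lf0) e0.
move=> h; rewrite /zeta.
apply: le_trans (h _ _ _ _ _ _ kN) _;
  last by rewrite -mulr_sumr le_eqVlt; apply/orP; left; apply/eqP; ring.
- by rewrite subrr norm2_0.
- by move=> i; exact: norm2_ge0.
- by move=> i; rewrite addr_ge0 ?norm2_ge0.
- move=> i iN; rewrite /z /xs /= -/z -/xs /fstar opprD addrA.
  apply: le_trans (ler_norm2D _ _) _; rewrite norm2N.
  have h1 := hLf (z i) (xs i) (a i iN).
  have h2 := hmis i (xs i) (a i iN).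
  by rewrite /fnom; lra.
- by move=> i _; exact: norms_le_ell.
Qed.

Lemma nominal_lipschitz y z nu N : admissible p N nu -> forall k, (k <= N)%N ->
  norm2 (traj f y nu k - traj f z nu k) ^+ 2 <= Lf ^+ (2 * k) * norm2 (y - z) ^+ 2.
Proof.
move=> a k kN; rewrite mulnC exprM -exprMn ler_pXn2r ?nnegrE ?norm2_ge0 //; last first.
  by rewrite mulr_ge0 ?norm2_ge0 // exprn_ge0 // ltW.
elim: k kN => [|k IH] kN; first by rewrite mul1r.
apply: le_trans (hLf _ _ (a k kN)) _.
by rewrite exprS -mulrA; apply: ler_wpM2l; [exact: ltW|exact/IH/ltnW].
Qed.

(** Treats the terminal cost as stage [N], so that the state part of the cost is a single sum of
    quadratic forms. *)
Definition stage_weight N k := if (k < N)%N then Qw p else Pw p.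

Lemma sum_stage_weight N (g : 'M[R]_n -> nat -> R) :
  \sum_(0 <= k < N.+1) g (stage_weight N k) k
  = \sum_(0 <= k < N) g (Qw p) k + g (Pw p) N.
Proof.
rewrite big_nat_recr //= /stage_weight ltnn; congr (_ + _).
by apply: eq_big_nat => k /andP[_ ->].
Qed.

Lemma cost_stage_weight N F x nu : cost p N F x nu =
  \sum_(0 <= k < N.+1) qform (stage_weight N k) (traj F x nu k)
  + \sum_(0 <= k < N) qform (Rw p) (nu k).
Proof.
rewrite (sum_stage_weight N (fun S k => qform S (traj F x nu k))) /cost /ell big_split /=.
by rewrite addrAC.
Qed.

(** Both costs use the same inputs, so only the state parts differ; the input cost is added under
    the root to restore the full cost. The weights [Lf ^+ (2 * k)] give [sigma1] and [sigma2], the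
    weights [zeta] the constants of [beta]. *)
Lemma cost_perturbation N F F' x x' nu (w : nat -> R) (E : R) :
  0 <= E -> (forall k, 0 <= w k) ->
  (forall k, (k <= N)%N -> norm2 (traj F x nu k - traj F' x' nu k) ^+ 2 <= w k * E) ->
  let s1 := eig_max (Qw p) ^+ 2 / eig_min (Qw p) * \sum_(0 <= k < N) w k
            + eig_max (Pw p) ^+ 2 / eig_min (Pw p) * w N in
  let s2 := eig_max (Qw p) * \sum_(0 <= k < N) w k + eig_max (Pw p) * w N in
  cost p N F x nu <= cost p N F' x' nu
    + 2 * Num.sqrt (cost p N F' x' nu * (E * s1)) + E * s2 /\ 0 <= s1 /\ 0 <= s2.
Proof.
move=> E0 w0 h s1 s2.
have pQ := posdef_Qw hp; have pP := posdef_Pw hp.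
have pS k : posdef (stage_weight N k) by rewrite /stage_weight; case: ifP.
have pos (S : 'M[R]_n) : posdef S -> 0 <= eig_max S by move=> pS'; exact: ltW (eig_max_gt0 n0 pS').
have pos' (S : 'M[R]_n) : posdef S -> 0 <= eig_max S ^+ 2 / eig_min S.
  by move=> pS'; apply: divr_ge0; [exact: sqr_ge0|exact: ltW (eig_min_gt0 n0 pS')].
have W0 : 0 <= \sum_(0 <= k < N) w k by apply: sumr_ge0.
have s10 : 0 <= s1 by apply: addr_ge0; apply: mulr_ge0 => //; exact: pos'.
have s20 : 0 <= s2 by apply: addr_ge0; apply: mulr_ge0 => //; exact: pos.
split=> //.
have := @sum_qform_perturbation R n (stage_weight N) (traj F x nu) (traj F' x' nu) w E N.+1
  n0 E0 pS w0 h.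
rewrite (sum_stage_weight N (fun S k => eig_max S ^+ 2 / eig_min S * w k)).
rewrite (sum_stage_weight N (fun S k => eig_max S * w k)) -!mulr_sumr -/s1 -/s2.
rewrite !cost_stage_weight.
set A := \sum_(0 <= k < N.+1) _; set B := \sum_(0 <= k < N.+1) _.
set r := \sum_(0 <= k < N) _.
have r0 : 0 <= r.
  by apply: sumr_ge0 => k _; exact: (posdef_qform_ge0 _ (posdef_Rw hp)).
have : Num.sqrt (B * (E * s1)) <= Num.sqrt ((B + r) * (E * s1)).
  by apply: ler_wsqrtr; apply: ler_wpM2r; [rewrite mulr_ge0|rewrite lerDl].
lra.
Qed.

Lemma sqrt_sqrM (a c : R) : 0 <= c -> Num.sqrt (a * c ^+ 2) = Num.sqrt a * c.
Proof. by move=> c0; rewrite mulrC sqrtrM ?sqr_ge0 // sqrtr_sqr ger0_norm // mulrC. Qed.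

(** With [E = e ^+ 2 * C], where [C] is the true cost, both perturbation terms become proportional
    to [C]. *)
Lemma nominal_cost_le_beta N y nu : (0 < N)%N -> admissible p N nu ->
  cost p N f y nu <= (1 + beta p Lf e N) * cost p N (fstar p) y nu.
Proof.
move=> N0 a; set C := cost p N (fstar p) y nu.
have C0 : 0 <= C by exact: cost_ge0.
have E0 : 0 <= e ^+ 2 * C by rewrite mulr_ge0 // sqr_ge0.
have h k : (k <= N)%N -> norm2 (traj f y nu k - traj (fstar p) y nu k) ^+ 2
    <= zeta p Lf k * (e ^+ 2 * C).
  move=> kN; apply: le_trans (model_error_bound y a kN) _.
  rewrite -mulrA; apply: ler_wpM2l; first exact: zeta_ge0.
  apply: ler_wpM2l; first exact: sqr_ge0.
  rewrite /C costE (@big_cat_nat _ _ _ k _ N) //= -addrA lerDl.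
  rewrite addr_ge0 ?ellT_ge0 // sumr_ge0 // => i _; exact: stage_cost_ge0.
have [] := cost_perturbation E0 zeta_ge0 h.
(* Both trajectories start at [y], so [zeta] vanishes at 0 and the sums may begin at 1 as in
   [beta]. *)
rewrite -/C big_ltn // zeta0 add0r /beta.
set s1 := (X in Num.sqrt (_ * (_ * X))); set s2 := eig_max (Qw p) * _ + eig_max (Pw p) * _.
move=> h1 [s10 s20].
have hs : Num.sqrt (C * (e ^+ 2 * C * s1)) = Num.sqrt s1 * (e * C).
  have -> : C * (e ^+ 2 * C * s1) = s1 * (e * C) ^+ 2 by ring.
  by rewrite sqrt_sqrM // mulr_ge0.
rewrite hs in h1; apply: le_trans h1 _.
by rewrite le_eqVlt; apply/orP; left; apply/eqP; ring.
Qed.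

Lemma beta_ge0 N : (0 < N)%N -> 0 <= beta p Lf e N.
Proof.
move=> N0; have pQ := posdef_Qw hp; have pP := posdef_Pw hp.
have Z0 : 0 <= \sum_(1 <= k < N) zeta p Lf k.
  by apply: sumr_ge0 => k _; exact: zeta_ge0.
rewrite addr_ge0 //; first by rewrite !mulr_ge0 // sqrtr_ge0.
apply: mulr_ge0; last exact: sqr_ge0.
by apply: addr_ge0; apply: mulr_ge0; rewrite ?zeta_ge0 // ltW // eig_max_gt0.
Qed.

(** The perturbation argument over one update interval, without terminal cost. The length [l] is
    enlarged to [M] so that one factor serves all intervals. *)
Lemma plant_stage_cost_le_theta (xs : nat -> 'cV[R]_n) nu t l M :
  (l <= M)%N -> (0 < M)%N -> admissible p l nu ->
  (forall k, (k < l)%N -> xs k.+1 = fstar p (t + k) (xs k) (nu k)) ->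
  \sum_(0 <= k < l) ell p (xs k) (nu k)
    <= (1 + theta p Lf b e M) * \sum_(0 <= k < l) stage_cost p f (xs 0%N) nu k.
Proof.
move=> lM M0 a hxs; set S := \sum_(0 <= k < l) stage_cost p f (xs 0%N) nu k.
have pQ := posdef_Qw hp.
have S0 : 0 <= S by apply: sumr_ge0 => k _; exact: stage_cost_ge0.
have E0 : 0 <= e ^+ 2 * S by rewrite mulr_ge0 // sqr_ge0.
have h k : (k < l)%N -> norm2 (xs k - traj f (xs 0%N) nu k) ^+ 2
    <= zetabar p Lf b k * (e ^+ 2 * S).
  move=> kl; apply: le_trans (plant_error_bound a hxs (ltnW kl)) _.
  rewrite -mulrA; apply: ler_wpM2l; first exact: zetabar_ge0.
  apply: ler_wpM2l; first exact: sqr_ge0.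
  rewrite /S (@big_cat_nat _ _ _ k _ l) //=; last exact: ltnW.
  rewrite lerDl sumr_ge0 // => i _; exact: stage_cost_ge0.
have := @sum_qform_perturbation R n (fun=> Qw p) xs (traj f (xs 0%N) nu)
  (zetabar p Lf b) (e ^+ 2 * S) l n0 E0 (fun=> pQ) zetabar_ge0 h.
rewrite -[\sum_(0 <= k < l) eig_max (Qw p) * _]mulr_sumr.
rewrite -[\sum_(0 <= k < l) _ / _ * _]mulr_sumr.
set Z := \sum_(0 <= k < l) zetabar p Lf b k.
set Y := \sum_(1 <= k < M) zetabar p Lf b k.
have Y0 : 0 <= Y by apply: sumr_ge0 => k _; exact: zetabar_ge0.
have Z0 : 0 <= Z by apply: sumr_ge0 => k _; exact: zetabar_ge0.
have ZY : Z <= Y.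
  have -> : Y = \sum_(0 <= k < M) zetabar p Lf b k by rewrite big_ltn // zetabar0 add0r.
  rewrite (@big_cat_nat _ _ _ l _ M) //= lerDl sumr_ge0 // => i _; exact: zetabar_ge0.
set Xq := \sum_(0 <= k < l) qform (Qw p) (xs k).
set Zq := \sum_(0 <= k < l) qform (Qw p) (traj _ _ _ k).
set Ru := \sum_(0 <= k < l) qform (Rw p) (nu k).
have -> : \sum_(0 <= k < l) ell p (xs k) (nu k) = Xq + Ru by rewrite -big_split.
have SE : S = Zq + Ru by rewrite -big_split.
have Ru0 : 0 <= Ru.
  by apply: sumr_ge0 => k _; exact: (posdef_qform_ge0 _ (posdef_Rw hp)).
have Zq0 : 0 <= Zq by apply: sumr_ge0 => k _; exact: qform_Qw_ge0.
have ZqS : Zq <= S by rewrite SE lerDl.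
have lmax := eig_max_gt0 n0 pQ; have lmin := eig_min_gt0 n0 pQ.
set c := eig_max (Qw p) ^+ 2 / eig_min (Qw p).
have c0 : 0 <= c by rewrite divr_ge0 ?sqr_ge0 // ltW.
have hs : Num.sqrt (Zq * (e ^+ 2 * S * (c * Z)))
    <= eig_max (Qw p) / Num.sqrt (eig_min (Qw p)) * Num.sqrt Y * (e * S).
  have -> : eig_max (Qw p) / Num.sqrt (eig_min (Qw p)) * Num.sqrt Y * (e * S)
     = Num.sqrt (c * Y * (e * S) ^+ 2).
    rewrite sqrt_sqrM ?mulr_ge0 // sqrtrM // /c sqrtrM ?sqr_ge0 //.
    by rewrite sqrtr_sqr (ger0_norm (ltW lmax)) sqrtrV ?ltW.
  apply: ler_wsqrtr.
  have -> : c * Y * (e * S) ^+ 2 = S * (e ^+ 2 * S * (c * Y)) by ring.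
  have cZ0 : 0 <= c * Z by exact: mulr_ge0.
  apply: ler_pM => //; first exact: mulr_ge0.
  by apply: ler_wpM2l => //; exact: ler_wpM2l.
have hq : e ^+ 2 * S * (eig_max (Qw p) * Z) <= e ^+ 2 * S * (eig_max (Qw p) * Y).
  by apply: ler_wpM2l => //; apply: ler_wpM2l => //; exact: ltW.
rewrite /theta -/Y; rewrite SE in hs hq *.
have expand : (1 + (2 * eig_max (Qw p) / Num.sqrt (eig_min (Qw p)) * Num.sqrt Y * e
    + eig_max (Qw p) * Y * e ^+ 2)) * (Zq + Ru)
  = Zq + Ru + 2 * (eig_max (Qw p) / Num.sqrt (eig_min (Qw p)) * Num.sqrt Y * (e * (Zq + Ru)))
    + e ^+ 2 * (Zq + Ru) * (eig_max (Qw p) * Y) by ring.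
rewrite expand; lra.
Qed.

Lemma theta_ge0 M : 0 <= theta p Lf b e M.
Proof.
have pQ := posdef_Qw hp; have l0 := ltW (eig_max_gt0 n0 pQ).
have Z0 : 0 <= \sum_(1 <= k < M) zetabar p Lf b k.
  by apply: sumr_ge0 => k _; exact: zetabar_ge0.
rewrite addr_ge0 //; first by rewrite !mulr_ge0 // ?invr_ge0 ?sqrtr_ge0.
by rewrite !mulr_ge0 ?sqr_ge0.
Qed.

Context (U0 : inputs p 0) (hopt : optimizers_exist p).
Context (gbar : R) (gam : nat -> R) (hcc : cost_controllable p gbar gam).
Context (kT : R) (hT : relaxed_clf p kT) (hpred : roa_predictions p).

(** The optimizer for the predicted state is a candidate at the true state [xs l]. The cost
    difference contributes [alpha], the nominal decrease contributes [delta]. *)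
Lemma plant_decrease N M (xs : nat -> 'cV[R]_n) nu t l :
  (0 < l)%N -> (l <= M)%N -> (M < N)%N ->
  roa p (xs 0%N) -> optimal p N f (xs 0%N) nu ->
  (forall k, (k < l)%N -> xs k.+1 = fstar p (t + k) (xs k) (nu k)) ->
  VN p N f (xs l) <= VN p N f (xs 0%N)
    - (1 - rho p Lf b e gbar gam kT N M)
      * \sum_(0 <= k < l) stage_cost p f (xs 0%N) nu k.
Proof.
move=> l0 lM MN rx o hxs; set S := \sum_(0 <= k < l) _; set x := xs 0%N in rx o S *.
have N0 : (0 < N)%N by exact: leq_trans MN.
have lN : (l <= N)%N by exact: leq_trans lM (ltnW MN).
have S0 : 0 <= S by apply: sumr_ge0 => k _; exact: stage_cost_ge0.
have al : admissible p l nu by move=> k kl; apply: o.1; exact: leq_trans kl lN.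
set z := traj f x nu l.
have err : norm2 (xs l - z) ^+ 2 <= zetabar p Lf b M * e ^+ 2 * S.
  apply: le_trans (plant_error_bound al hxs (leqnn l)) _.
  apply: ler_wpM2r => //; apply: ler_wpM2r; first exact: sqr_ge0.
  exact: zetabar_mono.
have dec := nominal_decrease hp U0 hopt hcc hT hpred l0 lM MN rx o.
rewrite -/z in dec.
have d0 := delta_ge0 hcc hT M N0; have g0 := gam_gt0 hcc N0.
set d := delta gbar gam kT N M in dec d0 *.
have qS : qform (Qw p) x <= S.
  rewrite /S big_ltn //; apply: le_trans (qform_le_ell hp x (nu 0%N)) _.
  by rewrite lerDl sumr_ge0 // => k _; exact: stage_cost_ge0.
have Vx := VN_controllable hp U0 hcc N0 rx.
have VE : VN p N f x = S + (\sum_(l <= k < N) stage_cost p f x nu k + ellT p (traj f x nu N)).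
  by rewrite (VN_optimal hp o) costE addrA -big_cat_nat.
have dS : d * qform (Qw p) x <= d * S by exact: ler_wpM2l.
(* Removing [S] from the value at [x] cancels the 1 in [1 + gam N], since [S >= qform (Qw p) x];
   what remains is the factor under the root in [alpha]. *)
have Vz : VN p N f z <= (gam N + d) * S.
  have : gam N * qform (Qw p) x <= gam N * S by apply: ler_wpM2l => //; exact: ltW.
  lra.
case: hopt => _ /(_ N z N0) [nu' o'] _.
have E0 : 0 <= zetabar p Lf b M * e ^+ 2 * S.
  by apply: mulr_ge0 => //; apply: mulr_ge0; [exact: zetabar_ge0|exact: sqr_ge0].
have Lk k : 0 <= Lf ^+ (2 * k) by apply/exprn_ge0/ltW.
have err' k : (k <= N)%N -> norm2 (traj f (xs l) nu' k - traj f z nu' k) ^+ 2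
    <= Lf ^+ (2 * k) * (zetabar p Lf b M * e ^+ 2 * S).
  move=> kN; apply: le_trans (nominal_lipschitz (xs l) z o'.1 kN) _.
  exact: ler_wpM2l.
have [] := cost_perturbation E0 Lk err'.
rewrite -/(sigma1 p Lf N) -/(sigma2 p Lf N) -(VN_optimal hp o') => h1 [s1 s2].
have h2 : VN p N f (xs l) <= cost p N f (xs l) nu' by apply: VN_le => //; exact: o'.1.
set E := zetabar p Lf b M in E0 h1 *.
have zM0 : 0 <= E by exact: zetabar_ge0.
have hs : Num.sqrt (VN p N f z * (E * e ^+ 2 * S * sigma1 p Lf N))
    <= Num.sqrt (sigma1 p Lf N * (gam N + d) * E) * (e * S).
  rewrite -sqrt_sqrM ?mulr_ge0 //; apply: ler_wsqrtr.
  have -> : sigma1 p Lf N * (gam N + d) * E * (e * S) ^+ 2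
    = (gam N + d) * S * (E * e ^+ 2 * S * sigma1 p Lf N) by ring.
  by apply: ler_wpM2r => //; rewrite mulr_ge0.
rewrite /rho -/d /alpha -/d -/E.
have expand : (1 - (d + (2 * Num.sqrt (sigma1 p Lf N * (gam N + d) * E) * e
     + sigma2 p Lf N * E * e ^+ 2))) * S
  = S - d * S - 2 * (Num.sqrt (sigma1 p Lf N * (gam N + d) * E) * (e * S))
     - E * e ^+ 2 * S * sigma2 p Lf N by ring.
rewrite expand; lra.
Qed.

End Perturbation.

(** * Nonnegative series and a limiting argument *)

Section NonnegativeSeries.
Context {R : realType}.
Implicit Types (u : nat -> R) (c : R).

Lemma partial_le_nneseries u k : (forall i, 0 <= u i) ->
  ((\sum_(0 <= i < k) u i)%:E <= \sum_(0 <= i <oo) (u i)%:E)%E.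
Proof.
by move=> u0; rewrite -sumEFin; apply: nneseries_lim_ge => i _ _; rewrite lee_fin.
Qed.

Lemma nneseries_le_bound u c : (forall i, 0 <= u i) ->
  (forall k, \sum_(0 <= i < k) u i <= c) ->
  (\sum_(0 <= i <oo) (u i)%:E <= c%:E)%E.
Proof.
move=> u0 h; apply: lime_le.
  by apply: is_cvg_nneseries => i _ _; rewrite lee_fin.
by apply: nearW => k; rewrite sumEFin lee_fin.
Qed.

(** If [t > G], an Archimedean choice of [N] gives [d N * t < t - G], contradicting
    [(1 - d N) * t <= G]. *)
Lemma le_of_vanishing_slack (t G C : R) (d : nat -> R) : 0 <= C -> 0 <= G ->
  (forall N, d N <= C / N.+1%:R) -> (forall N, (1 - d N) * t <= G) -> t <= G.
Proof.
move=> C0 G0 hd key; rewrite leNgt; apply/negP => Gt.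
have t0 : 0 < t by exact: le_lt_trans Gt.
have tG : 0 < t - G by rewrite subr_gt0.
have q0 : 0 <= C * t / (t - G) by apply: divr_ge0; [apply: mulr_ge0 => //|]; exact: ltW.
have := archi_boundP q0; move: (Num.bound _) => N hN.
have {}hN : C * t / (t - G) < N.+1%:R by apply: lt_le_trans hN _; rewrite ler_nat.
rewrite ltr_pdivrMr // in hN.
have h1 : d N * t <= C / N.+1%:R * t by apply: ler_wpM2r; [exact: ltW|exact: hd].
have h2 : C / N.+1%:R * t < t - G by rewrite mulrAC ltr_pdivrMr ?ltr0n // [ltRHS]mulrC.
have := key N; rewrite mulrBl mul1r.
by move: (le_lt_trans h1 h2); move: (d N * t) => y; clear; lra.
Qed.

End NonnegativeSeries.

(** * The infinite-horizon problem and nominal one-step MPC *)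

Section InfiniteHorizon.
Context {R : realType} {n m : nat} (p : plant R n m).
Context (hp : standing p) (U0 : inputs p 0).
Context (hopt : optimizers_exist p).
Context (gbar : R) (gam : nat -> R) (hcc : cost_controllable p gbar gam).
Context (kT : R) (hT : relaxed_clf p kT) (hpred : roa_predictions p).
Local Notation f := (fnom p).
Implicit Types (x y : 'cV[R]_n) (nu : nat -> 'cV[R]_m).

Lemma cost_oo_ge F x nu k :
  ((\sum_(0 <= i < k) stage_cost p F x nu i)%:E <= cost_oo p F x nu)%E.
Proof. by apply: partial_le_nneseries => i; exact: stage_cost_ge0. Qed.

Lemma cost_oo_le F x nu (c : R) :
  (forall k, \sum_(0 <= i < k) stage_cost p F x nu i <= c) ->
  (cost_oo p F x nu <= c%:E)%E.
Proof. by apply: nneseries_le_bound => i; exact: stage_cost_ge0. Qed.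

(** Membership in [roa] excludes the value [+oo] and nonnegative stage costs exclude [-oo], so the
    optimal value is a real number. *)
Lemma roa_optimal x : roa p x -> exists v nu,
  [/\ 0 <= v, Voo p (fstar p) x = v%:E, cost_oo p (fstar p) x nu = v%:E
    & optimal_oo p (fstar p) x nu].
Proof.
move=> rx; case: hopt => /(_ x rx) [nu [a o]] _ _.
have VE : Voo p (fstar p) x = cost_oo p (fstar p) x nu.
  apply/eqP; rewrite eq_le; apply/andP; split.
    by apply: ereal_inf_lbound; exists nu.
  by apply: le_ereal_inf_tmp => _ [nu' a' <-]; exact: o.
have v0 : (0 <= cost_oo p (fstar p) x nu)%E.
  by have := cost_oo_ge (fstar p) x nu 0; rewrite big_geq.
move: rx; rewrite /roa /= VE; move: v0.
case E : (cost_oo p (fstar p) x nu) => [v| |] // v0 _.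
by exists v, nu; split; rewrite // ?E.
Qed.

(* Closed loop of the nominal model under model predictive control with horizon
   [N] and one-step updates. *)
Lemma nominal_mpc_cost N y : (1 < N)%N -> roa p y ->
  exists2 nu, admissible_oo p nu & forall k,
    (1 - delta gbar gam kT N 1) * \sum_(0 <= i < k) stage_cost p f y nu i
      <= (1 + gbar) * qform (Qw p) y.
Proof.
move=> N1 ry; have N0 : (0 < N)%N by exact: ltnW.
case: hopt => _ /(_ N) ex _.
(* A choice of optimizers makes the first optimal input a state feedback; invariance under
   predictions keeps its closed loop in [roa]. *)
have [K oK] := choice (fun z => ex z N0).
pose ys t := iter t (fun z => nominal p z (K z 0%N)) y.
have rys t : roa p (ys t).
  elim: t => // t IH; have := hpred N0 IH (oK (ys t)) N0; exact.
pose nu t := K (ys t) 0%N.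
have trajE t : traj f y nu t = ys t by elim: t => //= t ->.
exists nu => [t|]; first by apply: (oK (ys t)).1.
set d := delta _ _ _ _ _.
have d0 : 0 <= d by exact: (delta_ge0 hcc hT 1 N0).
have step t : VN p N f (ys t.+1)
    <= VN p N f (ys t) - (1 - d) * stage_cost p f y nu t.
  have := nominal_decrease hp U0 hopt hcc hT hpred (ltnSn 0) (leqnn 1) N1 (rys t) (oK _).
  rewrite (VN_optimal hp (oK (ys t))) costE [\sum_(0 <= k < N) _]big_ltn //.
  have sE : stage_cost p f y nu t = stage_cost p f (ys t) (K (ys t)) 0%N.
    by rewrite /stage_cost trajE.
  rewrite -sE -/d.
  have : d * qform (Qw p) (ys t) <= d * stage_cost p f y nu t.
    by apply: ler_wpM2l => //; rewrite sE; exact: qform_le_ell.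
  rewrite [traj _ _ _ 1]/= -/(ys t.+1) /f; lra.
move=> k.
have V0 : 0 <= VN p N f (ys k).
  by rewrite (VN_optimal hp (oK (ys k))); exact: cost_ge0.
have : VN p N f (ys k) + (1 - d) * \sum_(0 <= i < k) stage_cost p f y nu i
    <= VN p N f y.
  elim: k {V0} => [|k IH]; first by rewrite big_geq // mulr0 addr0.
  by rewrite big_nat_recr //=; have := step k; lra.
have : VN p N f y <= (1 + gbar) * qform (Qw p) y.
  apply: le_trans (VN_controllable hp U0 hcc N0 ry) _.
  apply: ler_wpM2r; first exact: qform_Qw_ge0.
  by rewrite lerD2l; exact: (gam_le hcc N0).
by lra.
Qed.

(** [delta] decays like the inverse horizon because of [N - k] in its denominator. The offset 2
    guarantees a horizon above 1. *)
Lemma delta1_le N : delta gbar gam kT N.+2 1 <= (1 + gbar) * gbar * kT / N.+1%:R.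
Proof.
have k0 := hT.1; have g0 := gbar_gt0 hcc.
have gN := gam_gt0 hcc (ltn0Sn N.+1); have gle := gam_le hcc (ltn0Sn N.+1).
rewrite /delta expr1 subn1 /=; have -> : 1 + kT - 1 = kT by ring.
have N1 : 0 < N.+1%:R :> R by rewrite ltr0n.
have N1k : N.+1%:R <= N.+1%:R * (1 + kT) :> R by rewrite ler_peMr //; lra.
apply: ler_pM.
- by apply: mulr_ge0 => //; apply: mulr_ge0; lra.
- by rewrite invr_ge0; lra.
- by apply: ler_wpM2r => //; apply: ler_wpM2l => //; lra.
- by rewrite lef_pV2 ?posrE //; lra.
Qed.

(** * Exact model: the tail of the optimal cost *)

Context (mis0 : forall t x u, inputs p u -> mismatch p t x u = 0).

Lemma traj_no_mismatch x nu k : admissible p k nu ->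
  traj (fstar p) x nu k = traj f x nu k.
Proof.
elim: k => //= k IH a; rewrite IH => [|i ik]; last by apply: a; exact: ltnW.
by rewrite {1}/fstar mis0 ?addr0 //; exact: a.
Qed.

Lemma stage_cost_no_mismatch x nu k : admissible_oo p nu ->
  stage_cost p (fstar p) x nu k = stage_cost p f x nu k.
Proof. by move=> a; rewrite /stage_cost traj_no_mismatch // => i _. Qed.

(** Replacing the inputs after time [i] by nominal MPC with horizon [N.+2] cannot beat the optimum;
    letting [N] grow removes the factor [1 - delta]. *)
Lemma optimal_tail_le x nu v : roa p x -> optimal_oo p (fstar p) x nu ->
  cost_oo p (fstar p) x nu = v%:E -> forall i,
  v - \sum_(0 <= k < i) stage_cost p (fstar p) x nu k
    <= (1 + gbar) * qform (Qw p) (traj (fstar p) x nu i).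
Proof.
move=> rx [a o] vE i.
have ai : admissible p i nu by move=> k _; exact: a.
have sE k : stage_cost p (fstar p) x nu k = stage_cost p f x nu k.
  exact: stage_cost_no_mismatch.
rewrite traj_no_mismatch // (eq_bigr _ (fun k _ => sE k)).
set z := traj f x nu i; set s := \sum_(0 <= k < i) _.
have sv k : \sum_(0 <= l < k) stage_cost p f x nu l <= v.
  rewrite -lee_fin -vE -(eq_bigr _ (fun l _ => sE l)); exact: cost_oo_ge.
(* The shifted input has finite cost from [z]; it can be restarted at time 0 because the exact model
   is time-invariant. *)
have rz : roa p z.
  have az : admissible_oo p (fun k => nu (i + k)%N) by move=> k; exact: a.
  apply: (@le_lt_trans _ _ v%:E); last exact: ltry.
  apply: (@le_trans _ _ (cost_oo p (fstar p) z (fun k => nu (i + k)%N))).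
    by apply: ereal_inf_lbound; exists (fun k => nu (i + k)%N).
  apply: cost_oo_le => k; rewrite (eq_bigr _ (fun l _ => stage_cost_no_mismatch z l az)).
  rewrite sum_stage_cost_shift; apply: le_trans (sv (i + k)%N).
  rewrite (@big_cat_nat _ _ _ i 0 (i + k)) ?leq_addr //= lerDr.
  by apply: sumr_ge0 => l _; exact: stage_cost_ge0.
set G := (1 + gbar) * _.
have G0 : 0 <= G by apply: mulr_ge0; [have := gbar_gt0 hcc; lra|exact: qform_Qw_ge0].
have key N : (1 - delta gbar gam kT N.+2 1) * (v - s) <= G.
  have [nu' a' h] := nominal_mpc_cost (ltn0Sn N : (1 < N.+2)%N) rz.
  (* For a nonpositive factor the bound is trivial, as [v - s] and [G] are nonnegative. *)
  have [d1|d1] := leP (1 - delta gbar gam kT N.+2 1) 0.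
    by apply: le_trans G0; rewrite mulr_le0_ge0 // subr_ge0; exact: sv.
  have ag : admissible_oo p (glue i nu nu').
    by move=> k; rewrite /glue; case: ifP => _; [exact: a|exact: a'].
  suff : v <= s + G / (1 - delta gbar gam kT N.+2 1).
    by rewrite -lerBlDl ler_pdivlMr // mulrC.
  rewrite -lee_fin -vE; apply: le_trans (o _ ag) _; apply: cost_oo_le => k.
  (* Partial sums are extended to [i + k] terms so that they split at the switching time [i]. *)
  apply: le_trans (_ : \sum_(0 <= l < i + k) stage_cost p (fstar p) x (glue i nu nu') l <= _).
    rewrite [leRHS](@big_cat_nat _ _ _ k) ?leq_addl //= lerDl.
    by apply: sumr_ge0 => l _; exact: stage_cost_ge0.
  rewrite (eq_bigr _ (fun l _ => stage_cost_no_mismatch x l ag)) sum_stage_cost_glue.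
  by rewrite lerD2l ler_pdivlMr // mulrC; exact: h.
have g0 := gbar_gt0 hcc.
have C0 : 0 <= (1 + gbar) * gbar * kT.
  by apply: mulr_ge0 hT.1; apply: mulr_ge0; lra.
exact: (@le_of_vanishing_slack R (v - s) G _
  (fun N => delta gbar gam kT N.+2 1) C0 G0 delta1_le key).
Qed.

(** If [t] is the tail from stage [i], the stage cost at [i] is at least [t / (1 + gbar)], so the
    next tail is at most [gbar / (1 + gbar) * t]. *)
Lemma optimal_tail_decay x nu v : roa p x -> optimal_oo p (fstar p) x nu ->
  cost_oo p (fstar p) x nu = v%:E -> forall i,
  v - \sum_(0 <= k < i) stage_cost p (fstar p) x nu k
    <= (gbar / (1 + gbar)) ^+ i * v.
Proof.
move=> rx o vE; have g0 := gbar_gt0 hcc; elim=> [|i IH].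
  by rewrite big_geq // subr0 mul1r.
have h := optimal_tail_le rx o vE i; clear vE.
rewrite big_nat_recr //= exprS -mulrA.
set t := v - _ in h IH *.
have q : qform (Qw p) (traj (fstar p) x nu i) <= stage_cost p (fstar p) x nu i.
  exact: qform_le_ell.
have h' : t / (1 + gbar) <= stage_cost p (fstar p) x nu i.
  by apply: le_trans q; rewrite ler_pdivrMr; [rewrite mulrC; exact: h|lra].
have r0 : 0 <= gbar / (1 + gbar) by apply: divr_ge0; lra.
apply: le_trans (_ : gbar / (1 + gbar) * t <= _); last exact: ler_wpM2l.
have -> : gbar / (1 + gbar) * t = t - t / (1 + gbar) by field; lra.
by rewrite opprD addrA -/t; lra.
Qed.

End InfiniteHorizon.

(** * Truncating the optimal infinite-horizon input *)

Section TruncatedOptimalCost.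
Context {R : realType} {n m : nat} (p : plant R n m).
Context (n0 : (0 < n)%N) (m0 : (0 < m)%N) (hp : standing p) (U0 : inputs p 0).
Context (Lf e : R) (Lf0 : 0 < Lf) (e0 : 0 <= e).

Lemma mu_ce_gt0 : 0 < mu_ce p.
Proof.
apply: mulr_gt0 => //; apply: addr_gt0; rewrite invr_gt0; apply: eig_min_gt0 => //.
  exact: posdef_Qw.
exact: posdef_Rw.
Qed.

(* [zeta k >= mu_ce] for [k >= 1], so [beta] grows at least linearly in [N] as
   soon as there is any mismatch at all. *)
Lemma beta_oo_mismatch : 0 < e -> beta_oo p Lf e = +oo%E.
Proof.
move=> e1; apply/cvg_lim => //; apply/cvgeryP/cvgryPge => A.
have pQ := posdef_Qw hp; have pP := posdef_Pw hp.
pose c := eig_max (Qw p) * mu_ce p * e ^+ 2.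
have c0 : 0 < c.
  by rewrite mulr_gt0 ?exprn_gt0 // mulr_gt0 ?mu_ce_gt0 // eig_max_gt0.
have zeta_ge k : (0 < k)%N -> mu_ce p <= zeta p Lf k.
  move=> k0; rewrite /zeta -[leLHS]mulr1; apply: ler_wpM2l; first exact/ltW/mu_ce_gt0.
  rewrite big_ltn // muln0 expr0 lerDl; apply: sumr_ge0 => i _.
  exact/exprn_ge0/ltW.
have lower N : c * (N - 1)%:R <= beta p Lf e N.
  have Z0 : 0 <= eig_max (Pw p) * zeta p Lf N.
    by apply: mulr_ge0; [exact/ltW/eig_max_gt0|exact: zeta_ge0].
  have S0 : mu_ce p * (N - 1)%:R <= \sum_(1 <= k < N) zeta p Lf k.
    rewrite mulr_natr -sumr_const_nat; apply: ler_sum_nat => k /andP[k0 _].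
    exact: zeta_ge.
  have Q0 : eig_max (Qw p) * (mu_ce p * (N - 1)%:R)
      <= eig_max (Qw p) * \sum_(1 <= k < N) zeta p Lf k.
    by apply: ler_wpM2l => //; exact/ltW/eig_max_gt0.
  (* The root term is nonnegative and is dropped; the quadratic term already diverges. *)
  rewrite /beta; set s := Num.sqrt _.
  have s0 : 0 <= 2 * s * e by rewrite mulr_ge0 // mulr_ge0 // sqrtr_ge0.
  have := ler_wpM2r (sqr_ge0 e) (lerD Q0 Z0).
  by rewrite addr0 /c; lra.
pose N0 := Num.bound (`|A| / c).
have N0b : A <= c * N0%:R.
  have : `|A| / c < N0%:R by apply: archi_boundP; rewrite divr_ge0 // ltW.
  by rewrite ltr_pdivrMr // mulrC => /ltW; apply: le_trans; exact: ler_norm.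
exists N0.+1 => // N /= NN; apply: le_trans N0b _; apply: le_trans (lower N).
by rewrite ler_pM2l // ler_nat leq_subRL // (leq_ltn_trans _ NN).
Qed.

Lemma beta_oo_no_mismatch : beta_oo p Lf 0 = 0%E.
Proof.
rewrite /beta_oo (_ : (fun N => (beta p Lf 0 N)%:E) = fun=> 0%E); last first.
  by apply/funext => N; rewrite /beta mulr0 expr0n mulr0 addr0.
exact: lim_cst.
Qed.

Lemma ellT_le_Qw x : ellT p x <= eig_max (Pw p) / eig_min (Qw p) * qform (Qw p) x.
Proof.
have pQ := posdef_Qw hp; have pP := posdef_Pw hp.
have q0 := eig_min_gt0 n0 pQ; have P0 := ltW (eig_max_gt0 n0 pP).
apply: le_trans ((rayleigh_max n0 pP.1).2 x) _.
rewrite -mulrA; apply: ler_wpM2l => //.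
by rewrite ler_pdivlMl //; exact: (rayleigh_min n0 pQ.1).2.
Qed.

Context (hopt : optimizers_exist p).
Context (hmis : forall t x u, inputs p u ->
  norm2 (mismatch p t x u) <= e * (norm2 x + norm2 u)).
Context (gbar : R) (gam : nat -> R) (hcc : cost_controllable p gbar gam).
Context (kT : R) (hT : relaxed_clf p kT) (hpred : roa_predictions p).

(** The witness is an infinite-horizon optimizer. Its first [N] stage costs sum to at most [v], and
    the terminal cost is comparable with the stage cost at [N], hence bounded by the tail. *)
Lemma truncated_optimal_cost x N : roa p x ->
  exists v nu, [/\ Voo p (fstar p) x = v%:E, 0 <= v, admissible p N nu &
    cost p N (fstar p) x nu <= (1 + eig_max (Pw p) / eig_min (Qw p)
      * gamma_ratio (gammabar_star p Lf e gbar) ^+ N) * v].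
Proof.
move=> rx; have [v [nu [v0 Vv Cv o]]] := roa_optimal hp hopt rx.
exists v, nu; split => //; first by move=> k _; exact: o.1.
have g0 := gbar_gt0 hcc.
have sv k : \sum_(0 <= l < k) stage_cost p (fstar p) x nu l <= v.
  by rewrite -lee_fin -Cv; exact: cost_oo_ge.
have tail : v - \sum_(0 <= k < N) stage_cost p (fstar p) x nu k
    <= gamma_ratio (gammabar_star p Lf e gbar) ^+ N * v.
  have [e_eq0|en0] := eqVneq e 0.
    have mis0 t y u : inputs p u -> mismatch p t y u = 0.
      move=> Uu; apply/eqP; rewrite -norm2_eq0 eq_le norm2_ge0 andbT.
      by have := hmis t y Uu; rewrite e_eq0 mul0r.
    rewrite e_eq0 /gammabar_star beta_oo_no_mismatch mule0 !adde0 /=.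
    exact: (optimal_tail_decay hp U0 hopt hcc hT hpred mis0 rx o Cv).
  (* Since [gbar > 0], the product [gbar * +oo] is [+oo]; the ratio is then 1 and the tail only has
     to be at most [v]. *)
  rewrite /gammabar_star beta_oo_mismatch ?lt_def ?en0 // gt0_muley ?lte_fin //=.
  rewrite expr1n mul1r lerBlDr lerDl.
  by apply: sumr_ge0 => k _; exact: stage_cost_ge0.
rewrite costE.
have l0 : 0 <= eig_max (Pw p) / eig_min (Qw p).
  apply: divr_ge0; apply: ltW; [apply: eig_max_gt0|apply: eig_min_gt0] => //.
    exact: posdef_Pw.
  exact: posdef_Qw.
have q : qform (Qw p) (traj (fstar p) x nu N)
    <= v - \sum_(0 <= k < N) stage_cost p (fstar p) x nu k.
  rewrite lerBrDl; apply: le_trans (sv N.+1); rewrite big_nat_recr //= lerD2l.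
  exact: qform_le_ell.
have h1 := ellT_le_Qw (traj (fstar p) x nu N).
have h2 := ler_wpM2l l0 (le_trans q tail).
have h3 := sv N; rewrite mulrDl mul1r -mulrA.
exact: lerD h3 (le_trans h1 h2).
Qed.

End TruncatedOptimalCost.

(** * Closed-loop cost, stability and performance *)

Section ClosedLoop.
Context {R : realType} {n m : nat} (p : plant R n m).
Context (n0 : (0 < n)%N) (m0 : (0 < m)%N) (hp : standing p) (U0 : inputs p 0).
Context (Lf e b : R) (Lf0 : 0 < Lf) (e0 : 0 <= e) (eb : e <= b).
Context (hLf : forall x x' u, inputs p u ->
  norm2 (nominal p x u - nominal p x' u) <= Lf * norm2 (x - x')).
Context (hmis : forall t x u, inputs p u ->
  norm2 (mismatch p t x u) <= e * (norm2 x + norm2 u)).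
Context (hopt : optimizers_exist p).
Context (gbar : R) (gam : nat -> R) (hcc : cost_controllable p gbar gam).
Context (kT : R) (hT : relaxed_clf p kT) (hpred : roa_predictions p).
Context (M N : nat) (M0 : (0 < M)%N) (MN : (M < N)%N).
Context (tau : nat -> nat) (htau : feedback_times M tau).
Context (nus : nat -> 'cV[R]_n -> nat -> 'cV[R]_m) (hnus : mpc_controller p N nus).
Context (hupd : roa_updates p tau nus).
Local Notation rhoNM := (rho p Lf b e gbar gam kT N M).
Local Notation thetaM := (theta p Lf b e M).
Context (hrho : rhoNM < 1).
Context (x : nat -> 'cV[R]_n) (hx : closed_loop p tau nus x) (x0 : roa p (x 0%N)).

Definition period_cost j : R :=
  \sum_(0 <= k < tau j.+1 - tau j) ell p (x (tau j + k)%N) (nus j (x (tau j)) k).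

Lemma period_cost_ge0 j : 0 <= period_cost j.
Proof. by apply: sumr_ge0 => k _; exact: ell_ge0. Qed.

(** On each period the true cost is at most [1 + theta] times the predicted one, while [VN] drops by
    at least [1 - rho] times the predicted one; the drops telescope. *)
Lemma sum_period_cost J : \sum_(0 <= j < J) period_cost j
  <= (1 + thetaM) / (1 - rhoNM) * VN p N (fnom p) (x 0%N).
Proof.
have N0 : (0 < N)%N by exact: leq_trans MN.
have r0 : 0 < 1 - rhoNM by rewrite subr_gt0.
have th0 : 0 <= thetaM by exact: theta_ge0.
pose S j := \sum_(0 <= k < tau j.+1 - tau j)
  stage_cost p (fnom p) (x (tau j)) (nus j (x (tau j))) k.
have period j : period_cost j <= (1 + thetaM) * S j /\
    VN p N (fnom p) (x (tau j.+1)) <= VN p N (fnom p) (x (tau j)) - (1 - rhoNM) * S j.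
  have /andP[t1 t2] := htau.2 j; have rj := hupd hx x0 j.
  have l0 : (0 < tau j.+1 - tau j)%N by rewrite subn_gt0.
  have lM : (tau j.+1 - tau j <= M)%N by rewrite leq_subLR.
  pose xs k := x (tau j + k)%N.
  have xs0 : xs 0%N = x (tau j) by rewrite /xs addn0.
  have xsl : xs (tau j.+1 - tau j)%N = x (tau j.+1) by rewrite /xs subnKC // ltnW.
  have o : optimal p N (fnom p) (xs 0%N) (nus j (x (tau j))) by rewrite xs0; exact: hnus.
  have dyn k : (k < tau j.+1 - tau j)%N ->
      xs k.+1 = fstar p (tau j + k) (xs k) (nus j (x (tau j)) k).
    by move=> kl; rewrite /xs addnS; exact: hx.
  have a : admissible p (tau j.+1 - tau j) (nus j (x (tau j))).
    move=> k kl; apply: o.1; apply: leq_trans kl _.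
    exact: leq_trans lM (ltnW MN).
  split.
    have := plant_stage_cost_le_theta n0 m0 hp Lf0 e0 eb hLf hmis lM M0 a dyn.
    by rewrite xs0.
  rewrite -xs0 in rj.
  have := plant_decrease n0 m0 hp Lf0 e0 eb hLf hmis U0 hopt hcc hT hpred
    l0 lM MN rj o dyn.
  by rewrite xs0 xsl.
have sumS : (1 - rhoNM) * \sum_(0 <= j < J) S j <= VN p N (fnom p) (x 0%N).
  have V0 : 0 <= VN p N (fnom p) (x (tau J)).
    (* The update index 0 is arbitrary: the controller is optimal at every state for every index. *)
    by rewrite (VN_optimal hp (hnus 0 _)); exact: cost_ge0.
  suff : VN p N (fnom p) (x (tau J)) + (1 - rhoNM) * \sum_(0 <= j < J) S j
      <= VN p N (fnom p) (x 0%N) by lra.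
  elim: J {V0} => [|J IH]; first by rewrite big_geq // mulr0 addr0 htau.1.
  by rewrite big_nat_recr //=; have := (period J).2; lra.
apply: le_trans (_ : (1 + thetaM) * \sum_(0 <= j < J) S j <= _).
  by rewrite mulr_sumr; apply: ler_sum => j _; exact: (period j).1.
rewrite -mulrA; apply: ler_wpM2l; first by lra.
by rewrite mulrC ler_pdivlMr // mulrC.
Qed.

(** The factor of [sum_period_cost] times the controllability bound on [VN]: total closed-loop cost
    relative to [ell_star] at the initial state. *)
Definition gain : R := (1 + thetaM) / (1 - rhoNM) * (1 + gbar).

Lemma gain_ge0 : 0 <= gain.
Proof.
have th0 : 0 <= thetaM by exact: theta_ge0.
have g0 := gbar_gt0 hcc.
apply: mulr_ge0; last by lra.
by apply: divr_ge0; [lra|rewrite subr_ge0 ltW].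
Qed.

Lemma sum_qform_closed_loop T :
  \sum_(0 <= t < T) qform (Qw p) (x t) <= gain * qform (Qw p) (x 0%N).
Proof.
have N0 : (0 < N)%N by exact: leq_trans MN.
(* Periods have length at least 1, so the first [T] of them cover all times below [T]. *)
have tau_ge J : (J <= tau J)%N.
  elim: J => // J IH; have /andP[t1 _] := htau.2 J; exact: leq_ltn_trans IH t1.
have bound J : \sum_(0 <= t < tau J) qform (Qw p) (x t)
    <= \sum_(0 <= j < J) period_cost j.
  elim: J => [|J IH]; first by rewrite htau.1 !big_geq.
  have /andP[t1 _] := htau.2 J.
  rewrite (@big_cat_nat _ _ _ (tau J)) //=; last exact: ltnW.
  rewrite [leRHS]big_nat_recr //=; apply: lerD => //.
  rewrite -[X in \sum_(X <= _ < _) _]add0n big_addn; apply: ler_sum => k _.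
  rewrite addnC; exact: qform_le_ell.
apply: le_trans (_ : \sum_(0 <= t < tau T) qform (Qw p) (x t) <= _).
  rewrite [leRHS](@big_cat_nat _ _ _ T) //= lerDl.
  by apply: sumr_ge0 => t _; exact: qform_Qw_ge0.
apply: le_trans (bound T) _; apply: le_trans (sum_period_cost T) _.
rewrite /gain -[leRHS]mulrA; apply: ler_wpM2l.
  have th0 : 0 <= thetaM by exact: theta_ge0.
  by apply: divr_ge0; [lra|rewrite subr_ge0 ltW].
apply: le_trans (VN_controllable hp U0 hcc N0 x0) _.
apply: ler_wpM2r; first exact: qform_Qw_ge0.
by rewrite lerD2l; exact: (gam_le hcc N0).
Qed.

Lemma qform_closed_loop_cvg0 : qform (Qw p) (x t) @[t --> \oo] --> (0 : R).
Proof.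
apply: cvg_series_cvg_0; apply: nondecreasing_is_cvgn.
  apply/nondecreasing_seqP => T; rewrite /series /= big_nat_recr //= lerDl.
  exact: qform_Qw_ge0.
exists (gain * qform (Qw p) (x 0%N)) => _ [T _ <-]; exact: sum_qform_closed_loop.
Qed.

Lemma closed_loop_cvg0 : norm2 (x t) @[t --> \oo] --> (0 : R).
Proof.
have pQ := posdef_Qw hp; have q0 := eig_min_gt0 n0 pQ.
apply/cvgr0Pnorm_lt => eps eps0.
have d0 : 0 < eig_min (Qw p) * eps ^+ 2 by rewrite mulr_gt0 // exprn_gt0.
move: qform_closed_loop_cvg0 => /cvgr0Pnorm_lt /(_ _ d0).
apply: filterS => t; rewrite !ger0_norm ?norm2_ge0 ?qform_Qw_ge0 // => h.
rewrite -(@ltr_pXn2r _ 2) ?nnegrE ?norm2_ge0 ?ltW // -(ltr_pM2l q0).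
exact: le_lt_trans ((rayleigh_min n0 pQ.1).2 (x t)) h.
Qed.

(** Each summand is below the whole sum, so the bound is uniform in time and linear in the initial
    norm, which yields Lyapunov stability. *)
Lemma closed_loop_norm_bound t :
  norm2 (x t) <= Num.sqrt (gain * eig_max (Qw p) / eig_min (Qw p)) * norm2 (x 0%N).
Proof.
have pQ := posdef_Qw hp; have q0 := eig_min_gt0 n0 pQ.
have Q0 := ltW (eig_max_gt0 n0 pQ).
have K0 : 0 <= gain * eig_max (Qw p) / eig_min (Qw p).
  by apply: divr_ge0; [apply: mulr_ge0 gain_ge0 Q0|exact: ltW].
set K := _ / _ in K0 *.
have K1 : 0 <= Num.sqrt K * norm2 (x 0%N) by rewrite mulr_ge0 ?sqrtr_ge0 ?norm2_ge0.
rewrite -(@ler_pXn2r _ 2) ?nnegrE ?norm2_ge0 // exprMn (sqr_sqrtr K0).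
rewrite -(ler_pM2l q0) [leRHS]mulrA [_ * K]mulrC /K divfK ?gt_eqF //.
apply: le_trans ((rayleigh_min n0 pQ.1).2 (x t)) _.
apply: le_trans (_ : gain * qform (Qw p) (x 0%N) <= _).
  apply: le_trans (sum_qform_closed_loop t.+1); rewrite big_nat_recr //= lerDr.
  by apply: sumr_ge0 => i _; exact: qform_Qw_ge0.
rewrite -[leRHS]mulrA; apply: ler_wpM2l; first exact: gain_ge0.
exact: (rayleigh_max n0 pQ.1).2.
Qed.

(** The total cost is bounded through [VN] at the initial state, [VN] through the true cost of the
    truncated optimal input, and the latter through [Voo]. *)
Lemma closed_loop_performance : (performance p tau nus x
  <= (Rstar p Lf b e gbar gam kT N M)%:E * Voo p (fstar p) (x 0%N))%E.
Proof.
have N0 : (0 < N)%N by exact: leq_trans MN.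
have [v [nu [-> v0 a hC]]] := truncated_optimal_cost n0 m0 hp U0 Lf0 e0 hopt hmis
  hcc hT hpred N x0.
rewrite -EFinM; apply: nneseries_le_bound => [j|J]; first exact: period_cost_ge0.
apply: le_trans (sum_period_cost J) _; rewrite /Rstar.
have th0 : 0 <= thetaM by exact: theta_ge0.
have r0 : 0 < 1 - rhoNM by rewrite subr_gt0.
have C0 : 0 <= cost p N (fstar p) (x 0%N) nu by exact: cost_ge0.
have b0 : 0 <= beta p Lf e N by exact: beta_ge0.
have g0 := gbar_gt0 hcc.
set mn := Num.min _ _; set r := 1 + _ * _ ^+ N in hC *.
have mn0 : 0 <= mn by rewrite le_min b0 ltW.
(* In the minimum, [gbar] comes from cost controllability, as the first stage cost dominates
   [ell_star], and [beta] from running the same inputs on the nominal model. *)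
have VC : VN p N (fnom p) (x 0%N) <= (1 + mn) * cost p N (fstar p) (x 0%N) nu.
  rewrite /mn; case: (leP gbar (beta p Lf e N)) => _.
    apply: le_trans (VN_controllable hp U0 hcc N0 x0) _.
    apply: ler_pM; first by have := gam_gt0 hcc N0; lra.
    - exact: qform_Qw_ge0.
    - by rewrite lerD2l; exact: (gam_le hcc N0).
    rewrite costE big_ltn // -addrA; apply: le_trans (qform_le_ell hp _ (nu 0%N)) _.
    rewrite lerDl; apply: addr_ge0; last exact: ellT_ge0.
    by apply: sumr_ge0 => k _; exact: stage_cost_ge0.
  apply: le_trans (VN_le hp (fnom p) (x 0%N) a) _.
  exact: (nominal_cost_le_beta n0 m0 hp Lf0 e0 hLf hmis (x 0%N) N0 a).
have -> : (1 + mn) * (1 + thetaM) / (1 - rhoNM) * r * v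
   = (1 + thetaM) / (1 - rhoNM) * ((1 + mn) * (r * v)) by ring.
apply: ler_wpM2l; first by apply: divr_ge0; [lra|exact: ltW].
by apply: le_trans VC _; apply: ler_wpM2l => //; lra.
Qed.

End ClosedLoop.

(** * Asymptotic stability and the performance bound *)

Unset Implicit Arguments.

Theorem theorem2 (R : realType) (n m : nat) (hn : (0 < n)%N) (hm : (0 < m)%N)
    (p : plant R n m) (hp : standing p) (hopt : optimizers_exist p)
    (Lf : R) (LD : R -> R) (eps epsbar : R) (hsys : system_hyp p Lf LD eps epsbar)
    (gbar : R) (gam : nat -> R) (hcc : cost_controllable p gbar gam)
    (kT : R) (hT : relaxed_clf p kT)
    (M N : nat) (hM : (1 <= M)%N) (hMN : (M <= N - 1)%N)
    (tau : nat -> nat) (htau : feedback_times M tau)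
    (nus : nat -> 'cV[R]_n -> nat -> 'cV[R]_m) (hnus : mpc_controller p N nus)
    (hpred : roa_predictions p) (hupd : roa_updates p tau nus)
    (hrho : rho p Lf (LD epsbar) (LD eps) gbar gam kT N M < 1) :
  asymptotically_stable (roa p) (closed_loop p tau nus) /\
  (forall x : nat -> 'cV[R]_n, closed_loop p tau nus x -> roa p (x 0%N) ->
    (performance p tau nus x
      <= (Rstar p Lf (LD epsbar) (LD eps) gbar gam kT N M)%:E
         * Voo p (fstar p) (x 0%N))%E).
Proof.
case: hsys => [[_ mis00] intU [Lf0 hLf] [/andP[eps0 epsb] LD0 LDmono _ _] hmisL].
have U0 : inputs p 0 by exact: interior_subset.
have MN : (M < N)%N by lia.
have e0 := LD0 eps eps0; have eb := LDmono eps epsbar eps0 epsb.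
(* The Lipschitz condition is compared with the origin, where the mismatch vanishes. *)
have hmis t x u : inputs p u ->
    norm2 (mismatch p t x u) <= LD eps * (norm2 x + norm2 u).
  by move=> Uu; have := hmisL t x 0 u 0 Uu U0; rewrite mis00 !subr0.
split; last first.
  by move=> x hx x0; exact: (closed_loop_performance hn hm hp U0 Lf0 e0 eb hLf hmis
    hopt hcc hT hpred hM MN htau hnus hupd hrho hx x0).
split=> [eps' eps'0|x hx x0]; last first.
  exact: (closed_loop_cvg0 hn hm hp U0 Lf0 e0 eb hLf hmis
    hopt hcc hT hpred hM MN htau hnus hupd hrho hx x0).
pose K := Num.sqrt (gain p Lf (LD eps) (LD epsbar) gbar gam kT M N
  * eig_max (Qw p) / eig_min (Qw p)).
have K0 : 0 <= K by exact: sqrtr_ge0.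
have K1 : 0 < K + 1 by lra.
(* Dividing by [K + 1] covers the case [K = 0]. *)
exists (eps' / (K + 1)) => [|x hx x0 xd t]; first exact: divr_gt0.
have := closed_loop_norm_bound hn hm hp U0 Lf0 e0 eb hLf hmis
  hopt hcc hT hpred hM MN htau hnus hupd hrho hx x0 t.
rewrite -/K => /le_lt_trans; apply; move: xd; rewrite ltr_pdivlMr // => xd.
apply: le_lt_trans xd; rewrite mulrC; apply: ler_wpM2l; first exact: norm2_ge0.
by rewrite lerDl.
Qed.
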